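(* Let $G=[g_1,\ldots,g_n]$ be a finitely generated abelian transcendental semigroup. If every Fatou component of $g_i$ is bounded for each $i=1,\ldots,n$, then $F(G)$ does not contain any asymptotic values of $G$.
   Context: $G=[g_1,\ldots,g_n]$ is the set of all finite compositions (of length at least one) of the transcendental entire functions $g_1,\ldots,g_n$; it is abelian if $g_i\circ g_j=g_j\circ g_i$ for all $1\le i,j\le n$. The Fatou set $F(G)$ is the largest open subset of $\mathbb{C}$ on which the family $G$ is normal (every sequence in $G$ has a subsequence converging locally uniformly to a holomorphic function or to $\infty$); for a single transcendental entire $g$, $F(g)=F([g])$ is the Fatou set of the iterates of $g$, and its connected components are the Fatou components of $g$. A point $\zeta\in\mathbb{C}$ is an asymptotic value of a transcendental entire function $f$ if there is a curve $\Gamma$ tending to infinity with $f(z)\to\zeta$ as $z\to\infty$ along $\Gamma$. A point is an asymptotic value of $G$ if it is an asymptotic value of some $g\in G$. *)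

(* Defs.v *)
From Stdlib Require Import Reals.
From Stdlib Require Vectors.Fin.
From Coquelicot Require Import Coquelicot.

Open Scope R_scope.

Definition holomorphic_on (U : C -> Prop) (f : C -> C) : Prop :=
  forall z, U z -> ex_derive (K := C_AbsRing) f z.

Definition entire (f : C -> C) : Prop := holomorphic_on (fun _ => True) f.

Definition is_polynomial (f : C -> C) : Prop :=
  exists (d : nat) (a : nat -> C),
    forall z, f z = sum_n (fun k => Cmult (a k) (Cpow z k)) d.

Definition transcendental_entire (f : C -> C) : Prop :=
  entire f /\ ~ is_polynomial f.

Inductive generated (n : nat) (g : Fin.t n -> C -> C) : (C -> C) -> Prop :=
| generated_gen (i : Fin.t n) : generated n g (g i)
| generated_comp (f h : C -> C) :
    generated n g f -> generated n g h -> generated n g (fun z => f (h z)).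

Definition abelian_generators (n : nat) (g : Fin.t n -> C -> C) : Prop :=
  forall (i j : Fin.t n) (z : C), g i (g j z) = g j (g i z).

Definition loc_unif_cvg (U : C -> Prop) (u : nat -> C -> C) (phi : C -> C) : Prop :=
  forall p, U p -> exists V : C -> Prop, locally p V /\
    forall eps : R, 0 < eps ->
      eventually (fun k => forall z, V z -> U z -> Cmod (Cminus (u k z) (phi z)) < eps).

Definition loc_unif_cvg_infty (U : C -> Prop) (u : nat -> C -> C) : Prop :=
  forall p, U p -> exists V : C -> Prop, locally p V /\
    forall M : R,
      eventually (fun k => forall z, V z -> U z -> M < Cmod (u k z)).

Definition normal_on (U : C -> Prop) (F : (C -> C) -> Prop) : Prop :=
  forall u : nat -> C -> C, (forall k, F (u k)) ->
    exists s : nat -> nat, (forall k, (s k < s (S k))%nat) /\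
      ((exists phi : C -> C,
          holomorphic_on U phi /\ loc_unif_cvg U (fun k => u (s k)) phi) \/
       loc_unif_cvg_infty U (fun k => u (s k))).

(* The union of all open sets on which the family is normal.  Normality is thus
   a local property: on different connected components of the Fatou set the
   limits of one subsequence may be finite or infinite independently. *)
Definition fatou_set (F : (C -> C) -> Prop) (z : C) : Prop :=
  exists U : C -> Prop, open U /\ U z /\ normal_on U F.

Definition fatou_set_of_function (f : C -> C) : C -> Prop :=
  fatou_set (generated 1 (fun _ => f)).

(* Coquelicot's [is_connected] only concerns subsets of [R]. *)
Definition connected_set (A : C -> Prop) : Prop :=
  forall U V : C -> Prop, open U -> open V ->
    (forall z, A z -> U z \/ V z) ->
    (exists z, A z /\ U z) -> (exists z, A z /\ V z) ->
    exists z, A z /\ U z /\ V z.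

Definition connected_component_of (S A : C -> Prop) : Prop :=
  (exists z, A z) /\ connected_set A /\ (forall z, A z -> S z) /\
  forall B : C -> Prop, connected_set B -> (forall z, B z -> S z) ->
    (forall z, A z -> B z) -> forall z, B z -> A z.

Definition fatou_component (f : C -> C) (A : C -> Prop) : Prop :=
  connected_component_of (fatou_set_of_function f) A.

Definition bounded_set (A : C -> Prop) : Prop :=
  exists M : R, forall z, A z -> Cmod z <= M.

Definition asymptotic_value (f : C -> C) (zeta : C) : Prop :=
  exists gamma : R -> C,
    continuous_on (fun t => 0 <= t) gamma /\
    is_lim (fun t => Cmod (gamma t)) p_infty p_infty /\
    filterlim (fun t => f (gamma t)) (Rbar_locally p_infty) (locally zeta).

Definition family_asymptotic_value (F : (C -> C) -> Prop) (zeta : C) : Prop :=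
  exists f, F f /\ asymptotic_value f zeta.

(* Main.v *)
Require Import Defs.
From Stdlib Require Import Reals Lra Lia Wf_nat Classical ClassicalEpsilon FunctionalExtensionality.
From Stdlib Require Vectors.Fin.
From Coquelicot Require Import Coquelicot.

(** On the Fatou set of [g_1] everything reduces to backward invariance: if [a] is a generator
    and [a z] lies in [F(g_1)], then so does [z].  Indeed [u (a z) = a (u z)] for every iterate
    [u] of [g_1]; if a sequence [u_k o a] tends to infinity, so does [u_k], and if it has a finite
    limit then [a o u_k] is locally bounded, so that the [u_k] omit a disc on which the unbounded
    function [a] is large; the reciprocals [1 / (u_k - p)] are then bounded and zero-free and
    Montel and Hurwitz conclude.  Hence if [f (gamma t)] tends to a point of [F(G)], contained in
    [F(g_1)], a tail of [gamma] is an unbounded connected subset of [F(g_1)], and so lies in an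
    unbounded Fatou component of [g_1].

    Cauchy's formula is obtained from Goursat's theorem for rectangles in the logarithmic
    coordinate [z = z0 + exp w]: circle integrals of [(f z - f zeta) / (z - zeta) * (z - z0)]
    do not depend on the radius, except perhaps across the circle through [zeta], which continuity
    bridges; and at radius [0] they vanish. *)

(** * Continuity and complex differentiability *)

(** Passing to reciprocals puts the limit infinity at 0. [normal_on] asks for one alternative on the
    whole open set, and Hurwitz supplies it on a disc: the limit of the reciprocals is zero-free
    there or vanishes identically, so the subsequence converges throughout or escapes throughout. To
    leave room for this, the conclusion is drawn on a smaller concentric disc.

    Compactness is carried by finite Taylor expansions whose coefficient and remainder bounds are
    common to the whole family. Limits are then taken in finite sums only, and the limit function
    inherits the same bounds, from which its differentiability and the isolation of its zeros are
    read off.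

    Unboundedness of a generator comes from Liouville, a bounded entire function being a constant
    polynomial. The asymptotic value may belong to a long composition; backward invariance is
    applied to its factors one at a time, always for the Fatou set of the same generator. *)

Definition tends {T : Type} (F : (T -> Prop) -> Prop) (f : T -> C) (l : C) : Prop :=
  forall eps : R, 0 < eps -> F (fun x => Cmod (f x - l) < eps).

Lemma Cmod_minus_sym (x y : C) : Cmod (x - y) = Cmod (y - x).
Proof. rewrite <- Cmod_opp. f_equal. ring. Qed.

Lemma Cmod_triangle_minus (x y : C) : Cmod x <= Cmod (x - y) + Cmod y.
Proof. replace x with ((x - y) + y)%C at 1 by ring. apply Cmod_triangle. Qed.

Lemma Cmod_triangle3 (x y z : C) : Cmod (x - z) <= Cmod (x - y) + Cmod (y - z).
Proof. replace (x - z)%C with ((x - y) + (y - z))%C by ring. apply Cmod_triangle. Qed.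

(** [C] carries two uniform structures, the product one behind [locally] and [open], and that of the
    absolute value behind [ex_derive]; [locally_C] says that they have the same neighbourhoods. *)
Lemma locally_Cmod (z : C) (P : C -> Prop) :
  locally z P <-> exists d, 0 < d /\ forall w, Cmod (w - z) < d -> P w.
Proof.
  rewrite locally_C. split.
  - intros [d Hd]. exists d. split; [apply cond_pos|]. intros w Hw. apply Hd, Hw.
  - intros (d & d0 & Hd). exists (mkposreal d d0). intros w Hw. apply Hd, Hw.
Qed.

Lemma filterlim_tends {T : Type} (F : (T -> Prop) -> Prop) {FF : Filter F} (f : T -> C) (l : C) :
  filterlim f F (locally l) <-> tends F f l.
Proof.
  split.
  - intros H eps He. apply (H (fun y => Cmod (y - l) < eps)). apply locally_Cmod. exists eps. split; auto.
  - intros H P HP. apply locally_Cmod in HP. destruct HP as (d & d0 & Hd).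
    unfold filtermap. eapply filter_imp; [|apply (H d d0)]. intros x Hx; apply Hd, Hx.
Qed.

Lemma tends_const {T : Type} (F : (T -> Prop) -> Prop) {FF : Filter F} (c : C) :
  tends F (fun _ => c) c.
Proof.
  intros eps He. apply filter_forall. intros _. replace (c - c)%C with (RtoC 0) by ring.
  rewrite Cmod_0. exact He.
Qed.

Lemma tends_ext {T : Type} (F : (T -> Prop) -> Prop) {FF : Filter F} (f g : T -> C) (l : C) :
  F (fun x => f x = g x) -> tends F f l -> tends F g l.
Proof.
  intros E H eps He. generalize (@filter_and _ F _ _ _ E (H eps He)). apply filter_imp.
  intros x [e Hx]. rewrite <- e. exact Hx.
Qed.

Lemma tends_plus {T : Type} (F : (T -> Prop) -> Prop) {FF : Filter F} (f g : T -> C) (l m : C) :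
  tends F f l -> tends F g m -> tends F (fun x => f x + g x)%C (l + m)%C.
Proof.
  intros Hf Hg eps He.
  generalize (@filter_and _ F _ _ _ (Hf (eps / 2) ltac:(lra)) (Hg (eps / 2) ltac:(lra))).
  apply filter_imp. intros x [Hx Hy].
  replace (f x + g x - (l + m))%C with ((f x - l) + (g x - m))%C by ring.
  eapply Rle_lt_trans; [apply Cmod_triangle|]. lra.
Qed.

Lemma tends_mult {T : Type} (F : (T -> Prop) -> Prop) {FF : Filter F} (f g : T -> C) (l m : C) :
  tends F f l -> tends F g m -> tends F (fun x => f x * g x)%C (l * m)%C.
Proof.
  intros Hf Hg eps He.
  assert (A := Cmod_ge_0 l). assert (B := Cmod_ge_0 m).
  set (K := Cmod l + Cmod m + 1).
  assert (HK : 0 < K) by (unfold K; lra).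
  set (d := Rmin 1 (eps / (2 * K))).
  assert (d0 : 0 < d).
  { apply Rmin_pos; [lra|]. apply Rdiv_lt_0_compat; lra. }
  assert (d1 : d <= 1) by apply Rmin_l.
  assert (d2 : d * K <= eps / 2).
  { replace (eps / 2) with (eps / (2 * K) * K) by (field; lra).
    apply Rmult_le_compat_r; [lra|apply Rmin_r]. }
  generalize (@filter_and _ F _ _ _ (Hf d d0) (Hg d d0)).
  apply filter_imp. intros x [Hx Hy].
  replace (f x * g x - l * m)%C with ((f x - l) * (g x - m) + (f x - l) * m + l * (g x - m))%C by ring.
  eapply Rle_lt_trans; [apply Cmod_triangle|].
  eapply Rle_lt_trans; [apply Rplus_le_compat_r, Cmod_triangle|].
  rewrite !Cmod_mult.
  assert (P1 := Cmod_ge_0 (f x - l)). assert (P2 := Cmod_ge_0 (g x - m)).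
  assert (Cmod (f x - l) * Cmod (g x - m) <= d * 1) by (apply Rmult_le_compat; lra).
  assert (Cmod (f x - l) * Cmod m <= d * Cmod m) by (apply Rmult_le_compat_r; lra).
  assert (Cmod l * Cmod (g x - m) <= Cmod l * d) by (apply Rmult_le_compat_l; lra).
  unfold K in d2. nra.
Qed.

Lemma tends_minus {T : Type} (F : (T -> Prop) -> Prop) {FF : Filter F} (f g : T -> C) (l m : C) :
  tends F f l -> tends F g m -> tends F (fun x => f x - g x)%C (l - m)%C.
Proof.
  intros Hf Hg.
  apply (tends_ext F (fun x => f x + (-(1)) * g x)%C).
  - apply filter_forall; intros; ring.
  - replace (l - m)%C with (l + (-(1)) * m)%C by ring.
    apply tends_plus; [auto|exact Hf|]. apply tends_mult; [auto| |exact Hg]. apply tends_const; auto.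
Qed.

Lemma tends_inv {T : Type} (F : (T -> Prop) -> Prop) {FF : Filter F} (f : T -> C) (l : C) :
  l <> 0 -> tends F f l -> tends F (fun x => / f x)%C (/ l)%C.
Proof.
  intros l0 Hf eps He.
  assert (L : 0 < Cmod l) by (apply Cmod_gt_0, l0).
  set (d := Rmin (Cmod l / 2) (eps * (Cmod l * Cmod l) / 2)).
  assert (d0 : 0 < d).
  { apply Rmin_pos; [lra|]. assert (0 < Cmod l * Cmod l) by nra. nra. }
  generalize (Hf d d0). apply filter_imp. intros x Hx.
  assert (D1 := Rmin_l (Cmod l / 2) (eps * (Cmod l * Cmod l) / 2)).
  assert (D2 := Rmin_r (Cmod l / 2) (eps * (Cmod l * Cmod l) / 2)).
  fold d in D1, D2.
  assert (Hfx : Cmod l / 2 < Cmod (f x)).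
  { assert (T1 := Cmod_triangle_minus l (f x)). rewrite Cmod_minus_sym in T1. lra. }
  assert (f0 : f x <> 0) by (apply Cmod_gt_0; lra).
  replace (/ f x - / l)%C with ((l - f x) / (f x * l))%C by (field; split; auto).
  rewrite Cmod_div by (apply Cmult_neq_0; auto). rewrite Cmod_mult, Cmod_minus_sym.
  apply Rlt_div_l; [nra|]. apply Rlt_le_trans with d; [exact Hx|].
  apply Rle_trans with (eps * (Cmod l / 2 * Cmod l)); [lra|].
  apply Rmult_le_compat_l; [lra|]. apply Rmult_le_compat_r; lra.
Qed.

Lemma tends_unique {T : Type} (F : (T -> Prop) -> Prop) {FF : ProperFilter F} (f : T -> C) (l m : C) :
  tends F f l -> tends F f m -> l = m.
Proof.
  intros Hl Hm. apply NNPP; intro N.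
  assert (P : 0 < Cmod (l - m)).
  { apply Cmod_gt_0. intro E. apply N. replace l with ((l - m) + m)%C by ring. rewrite E. ring. }
  destruct (filter_ex _ (@filter_and _ F _ _ _ (Hl (Cmod (l - m) / 2) ltac:(lra)) (Hm (Cmod (l - m) / 2) ltac:(lra))))
    as [x [A B]].
  assert (T1 := Cmod_triangle3 l (f x) m). rewrite (Cmod_minus_sym l (f x)) in T1. lra.
Qed.

Lemma tends_Cmod_le {T : Type} (F : (T -> Prop) -> Prop) {FF : ProperFilter F} (f : T -> C) (l : C) (M : R) :
  tends F f l -> F (fun x => Cmod (f x) <= M) -> Cmod l <= M.
Proof.
  intros Hl HM. apply Rnot_lt_le; intro N.
  destruct (filter_ex _ (@filter_and _ F _ _ _ (Hl (Cmod l - M) ltac:(lra)) HM)) as [x [A B]].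
  assert (T1 := Cmod_triangle_minus l (f x)). rewrite Cmod_minus_sym in T1. lra.
Qed.

Definition cont (f : C -> C) (z : C) : Prop := tends (locally z) f (f z).

Lemma cont_comp (f g : C -> C) (z : C) :
  cont g z -> cont f (g z) -> cont (fun w => f (g w)) z.
Proof.
  intros Hg Hf eps He. destruct (proj1 (locally_Cmod _ _) (Hf eps He)) as (d & d0 & Hd).
  generalize (Hg d d0). apply filter_imp. intros w Hw. apply Hd, Hw.
Qed.

Lemma cont_id (z : C) : cont (fun w => w) z.
Proof. intros eps He. apply locally_Cmod. exists eps; split; auto. Qed.

Lemma cont_const (c z : C) : cont (fun _ => c) z.
Proof. exact (tends_const (locally z) c). Qed.

Lemma cont_plus (f g : C -> C) (z : C) : cont f z -> cont g z -> cont (fun w => f w + g w)%C z.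
Proof. exact (tends_plus (locally z) f g (f z) (g z)). Qed.

Lemma cont_minus (f g : C -> C) (z : C) : cont f z -> cont g z -> cont (fun w => f w - g w)%C z.
Proof. exact (tends_minus (locally z) f g (f z) (g z)). Qed.

Lemma cont_mult (f g : C -> C) (z : C) : cont f z -> cont g z -> cont (fun w => f w * g w)%C z.
Proof. exact (tends_mult (locally z) f g (f z) (g z)). Qed.

Lemma cont_inv (f : C -> C) (z : C) : f z <> 0 -> cont f z -> cont (fun w => / f w)%C z.
Proof. exact (tends_inv (locally z) f (f z)). Qed.

Lemma cont_ext (f g : C -> C) (z : C) :
  (exists d, 0 < d /\ forall w, Cmod (w - z) < d -> f w = g w) -> cont f z -> cont g z.
Proof.
  intros (d & d0 & Hd) H. unfold cont. rewrite <- (Hd z).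
  - apply (tends_ext (locally z) f g); [|exact H]. apply locally_Cmod. exists d; split; auto.
  - replace (z - z)%C with (RtoC 0) by ring. now rewrite Cmod_0.
Qed.

(* Caratheodory's form of differentiability: the difference quotient extends continuously,
   which makes the rules of calculus statements about continuity. *)
Definition cdiff (f : C -> C) (z : C) : Prop :=
  exists phi : C -> C, cont phi z /\ forall w, (f w - f z = phi w * (w - z))%C.

Lemma Cminus_eq_0 (x y : C) : (x - y)%C = 0 -> x = y.
Proof. intros E. replace x with ((x - y) + y)%C by ring. rewrite E. ring. Qed.

Lemma cdiff_intro (f : C -> C) (z l : C) :
  (forall eps, 0 < eps -> exists d, 0 < d /\ forall w, Cmod (w - z) < d ->
     Cmod (f w - f z - l * (w - z)) <= eps * Cmod (w - z)) -> cdiff f z.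
Proof.
  intros H.
  exists (fun w => if excluded_middle_informative (w = z) then l else (f w - f z) / (w - z))%C.
  split.
  - intros eps He. destruct (H (eps / 2) ltac:(lra)) as (d & d0 & Hd).
    apply locally_Cmod. exists d. split; [exact d0|].
    intros w Hw. destruct (excluded_middle_informative (z = z)) as [_|n]; [|now elim n].
    destruct (excluded_middle_informative (w = z)) as [e|n].
    + replace (l - l)%C with (RtoC 0) by ring. now rewrite Cmod_0.
    + assert (n' : (w - z)%C <> 0) by (intro E; apply n, Cminus_eq_0, E).
      specialize (Hd w Hw).
      replace ((f w - f z) / (w - z) - l)%C with (((f w - f z) - l * (w - z)) / (w - z))%C by (field; auto).
      rewrite Cmod_div by auto. assert (0 < Cmod (w - z)) by (apply Cmod_gt_0; auto).
      apply Rlt_div_l; [auto|]. nra.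
  - intros w. destruct (excluded_middle_informative (w = z)) as [e|n].
    + subst w. ring.
    + field. intro E. apply n, Cminus_eq_0, E.
Qed.

Lemma cdiff_ex_derive (f : C -> C) (z : C) : cdiff f z <-> ex_derive (K := C_AbsRing) f z.
Proof.
  split.
  - intros (phi & Hphi & E). exists (phi z). split.
    + apply (is_linear_scal_l (K := C_AbsRing) (V := C_NormedModule) (phi z)).
    + intros y Hy.
      apply (is_filter_lim_locally_unique (K := C_AbsRing) (V := AbsRing_NormedModule C_AbsRing)) in Hy.
      subst y. intros eps.
      destruct (proj1 (locally_Cmod _ _) (Hphi eps (cond_pos eps))) as (d & d0 & Hd).
      exists (mkposreal d d0). intros w Hw. specialize (Hd w Hw).
      change (Cmod ((f w - f z) - (w - z) * phi z) <= eps * Cmod (w - z)).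
      rewrite E. replace (phi w * (w - z) - (w - z) * phi z)%C with ((phi w - phi z) * (w - z))%C by ring.
      rewrite Cmod_mult. apply Rmult_le_compat_r; [apply Cmod_ge_0|]. lra.
  - intros [l [_ H]]. specialize (H z (fun P HP => HP)). apply (cdiff_intro f z l).
    intros eps He. destruct (H (mkposreal _ He)) as [d Hd]. exists d. split; [apply cond_pos|].
    intros w Hw. rewrite (Cmult_comm l). exact (Hd w Hw).
Qed.

Lemma cdiff_cont (f : C -> C) (z : C) : cdiff f z -> cont f z.
Proof.
  intros (phi & Hphi & E).
  apply (cont_ext (fun w => f z + phi w * (w - z))%C).
  - exists 1. split; [lra|]. intros w _. rewrite <- E. ring.
  - apply cont_plus; [apply cont_const|]. apply cont_mult; [auto|].
    apply cont_minus; [apply cont_id|apply cont_const].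
Qed.

Lemma cdiff_local (f g : C -> C) (z : C) :
  (exists d, 0 < d /\ forall w, Cmod (w - z) < d -> f w = g w) -> cdiff f z -> cdiff g z.
Proof.
  intros (d & d0 & E) (phi & Hphi & Ephi).
  assert (Ez : f z = g z).
  { apply E. replace (z - z)%C with (RtoC 0) by ring. now rewrite Cmod_0. }
  apply (cdiff_intro g z (phi z)). intros eps He.
  destruct (proj1 (locally_Cmod _ _) (Hphi eps He)) as (d' & d0' & Hd).
  exists (Rmin d d'). split; [apply Rmin_pos; auto|]. intros w Hw.
  assert (A := Rmin_l d d'). assert (B := Rmin_r d d').
  rewrite <- Ez, <- E, Ephi by lra.
  replace (phi w * (w - z) - phi z * (w - z))%C with ((phi w - phi z) * (w - z))%C by ring.
  rewrite Cmod_mult. apply Rmult_le_compat_r; [apply Cmod_ge_0|]. left. apply Hd. lra.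
Qed.

Lemma cdiff_const (c z : C) : cdiff (fun _ => c) z.
Proof. exists (fun _ => RtoC 0). split; [apply cont_const|]. intros; ring. Qed.

Lemma cdiff_id (z : C) : cdiff (fun w => w) z.
Proof. exists (fun _ => RtoC 1). split; [apply cont_const|]. intros; ring. Qed.

Lemma cdiff_minus (f g : C -> C) (z : C) :
  cdiff f z -> cdiff g z -> cdiff (fun w => f w - g w)%C z.
Proof.
  intros (p & Hp & Ep) (q & Hq & Eq). exists (fun w => p w - q w)%C. split.
  - apply cont_minus; auto.
  - intros w. replace (f w - g w - (f z - g z))%C with ((f w - f z) - (g w - g z))%C by ring.
    rewrite Ep, Eq. ring.
Qed.

Lemma cdiff_mult (f g : C -> C) (z : C) :
  cdiff f z -> cdiff g z -> cdiff (fun w => f w * g w)%C z.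
Proof.
  intros Hf Hg. assert (Cg := cdiff_cont _ _ Hg).
  destruct Hf as (p & Hp & Ep). destruct Hg as (q & Hq & Eq).
  exists (fun w => p w * g w + f z * q w)%C. split.
  - apply cont_plus; apply cont_mult; auto. apply cont_const.
  - intros w. replace (f w * g w - f z * g z)%C with ((f w - f z) * g w + f z * (g w - g z))%C by ring.
    rewrite Ep, Eq. ring.
Qed.

Lemma cdiff_comp (f g : C -> C) (z : C) :
  cdiff g z -> cdiff f (g z) -> cdiff (fun w => f (g w)) z.
Proof.
  intros Hg (p & Hp & Ep). assert (Cg := cdiff_cont _ _ Hg). destruct Hg as (q & Hq & Eq).
  exists (fun w => p (g w) * q w)%C. split.
  - apply cont_mult; auto. apply (cont_comp p g); auto.
  - intros w. rewrite Ep, Eq. ring.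
Qed.

Lemma cdiff_inv (f : C -> C) (z : C) : f z <> 0 -> cdiff f z -> cdiff (fun w => / f w)%C z.
Proof.
  intros f0 Hf. apply (cdiff_comp (fun w => / w)%C f); auto.
  (* The quotient identity is demanded at every [w], also at [w = 0], where [/ w] is a default
     value; there the difference quotient itself is taken. Near [f z] the other branch applies, and
     it is visibly continuous. *)
  exists (fun w : C => if excluded_middle_informative (w = RtoC 0)
                   then (/ w - / f z) / (w - f z) else - / (w * f z))%C.
  split.
  - apply (cont_ext (fun w => 0 - / (w * f z))%C).
    + exists (Cmod (f z)). split; [apply Cmod_gt_0; auto|].
      intros w Hw. destruct (excluded_middle_informative (w = RtoC 0)) as [e|n]; [|ring].
      exfalso. rewrite e, Cmod_minus_sym in Hw. replace (f z - 0)%C with (f z) in Hw by ring. lra.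
    + apply cont_minus; [apply cont_const|]. apply (cont_inv (fun w => w * f z)%C).
      * apply Cmult_neq_0; auto.
      * apply cont_mult; [apply cont_id|apply cont_const].
  - intros w. simpl. destruct (excluded_middle_informative (w = RtoC 0)) as [e|n].
    + set (u := (/ w)%C). field. split; [auto|]. intro E. apply f0. rewrite e in E. replace (f z) with (- (0 - f z))%C by ring. rewrite E. ring.
    + field. auto.
Qed.

(** * Path integrals and Goursat's theorem *)

Definition CInt (f : R -> C) (a b : R) : C := RInt (V := C_R_CompleteNormedModule) f a b.

Definition path_cont (f : R -> C) (a b : R) : Prop :=
  forall t, a <= t <= b -> tends (locally t) f (f t).

Lemma CInt_correct (f : R -> C) (a b : R) :
  a <= b -> path_cont f a b -> is_RInt (V := C_R_NormedModule) f a b (CInt f a b).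
Proof.
  intros ab Hf. apply (RInt_correct (V := C_R_CompleteNormedModule)).
  apply (ex_RInt_continuous (V := C_R_CompleteNormedModule)).
  intros t Ht. rewrite Rmin_left, Rmax_right in Ht by exact ab.
  exact (proj2 (filterlim_tends (locally t) f (f t)) (Hf t Ht)).
Qed.

Lemma CInt_ext (f g : R -> C) (a b : R) :
  a <= b -> (forall t, a <= t <= b -> f t = g t) -> CInt f a b = CInt g a b.
Proof.
  intros ab E. apply (RInt_ext (V := C_R_CompleteNormedModule)).
  intros t Ht. rewrite Rmin_left, Rmax_right in Ht by exact ab. apply E; lra.
Qed.

Lemma CInt_chasles (f : R -> C) (a b c : R) :
  a <= b -> b <= c -> path_cont f a c -> CInt f a c = (CInt f a b + CInt f b c)%C.
Proof.
  intros ab bc Hf. symmetry.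
  apply (RInt_Chasles (V := C_R_CompleteNormedModule)); eexists; apply CInt_correct; auto;
    intros t Ht; apply Hf; lra.
Qed.

Lemma CInt_minus (f g : R -> C) (a b : R) :
  a <= b -> path_cont f a b -> path_cont g a b ->
  CInt (fun t => f t - g t)%C a b = (CInt f a b - CInt g a b)%C.
Proof.
  intros ab Hf Hg.
  apply (RInt_minus (V := C_R_CompleteNormedModule)); eexists; apply CInt_correct; auto.
Qed.

Lemma CInt_plus (f g : R -> C) (a b : R) :
  a <= b -> path_cont f a b -> path_cont g a b ->
  CInt (fun t => f t + g t)%C a b = (CInt f a b + CInt g a b)%C.
Proof.
  intros ab Hf Hg.
  apply (RInt_plus (V := C_R_CompleteNormedModule)); eexists; apply CInt_correct; auto.
Qed.

Lemma CInt_const (c : C) (a b : R) : CInt (fun _ => c) a b = ((b - a)%R * c)%C.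
Proof.
  unfold CInt. rewrite (RInt_const (V := C_R_CompleteNormedModule)).
  change (((b - a) * fst c, (b - a) * snd c) = ((b - a)%R * c)%C).
  unfold Cmult, RtoC. simpl. f_equal; ring.
Qed.

Lemma CInt_bound (f : R -> C) (a b M : R) :
  a <= b -> path_cont f a b -> (forall t, a <= t <= b -> Cmod (f t) <= M) ->
  Cmod (CInt f a b) <= (b - a) * M.
Proof.
  intros ab Hf HM.
  assert (N : forall z : C, norm (V := C_R_NormedModule) z = Cmod z).
  { intros z. unfold Cmod. change (sqrt (Rabs (fst z) ^ 2 + Rabs (snd z) ^ 2) = sqrt (fst z ^ 2 + snd z ^ 2)).
    now rewrite !pow2_abs. }
  rewrite <- N. apply (norm_RInt_le_const (V := C_R_NormedModule) f a b); auto.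
  - intros t Ht. rewrite N. auto.
  - apply CInt_correct; auto.
Qed.

(** [CInt] views [C] as a real vector space, so only real scalars come out of the integral directly;
    a complex one is moved through the real and imaginary parts. *)
Lemma CInt_Cmult (c : C) (f : R -> C) (a b : R) :
  a <= b -> path_cont f a b -> CInt (fun t => c * f t)%C a b = (c * CInt f a b)%C.
Proof.
  intros ab Hf. apply (is_RInt_unique (V := C_R_CompleteNormedModule)).
  assert (H := CInt_correct f a b ab Hf).
  assert (H1 := is_RInt_fct_extend_fst (U := R_NormedModule) (V := R_NormedModule) f a b _ H).
  assert (H2 := is_RInt_fct_extend_snd (U := R_NormedModule) (V := R_NormedModule) f a b _ H).
  apply (is_RInt_fct_extend_pair (U := R_NormedModule) (V := R_NormedModule)).
  - apply (is_RInt_minus (V := R_NormedModule));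
      apply (is_RInt_scal (V := R_NormedModule)); assumption.
  - apply (is_RInt_plus (V := R_NormedModule));
      apply (is_RInt_scal (V := R_NormedModule)); assumption.
Qed.

(** * Integrals over boundaries of rectangles *)

Lemma Cmod_pair_le (x y : R) : Cmod (x, y) <= Rabs x + Rabs y.
Proof.
  replace ((x, y) : C) with (RtoC x + Ci * RtoC y)%C.
  - eapply Rle_trans; [apply Cmod_triangle|]. rewrite Cmod_mult, Cmod_Ci, !Cmod_R. lra.
  - unfold Cplus, Cmult, Ci, RtoC; simpl. f_equal; ring.
Qed.

Lemma Cmod_hline (x x' y : R) : Cmod ((x', y) - (x, y)) = Rabs (x' - x).
Proof.
  replace ((x', y) - (x, y))%C with (RtoC (x' - x)).
  - apply Cmod_R.
  - unfold Cminus, Cplus, Copp, RtoC; simpl. f_equal; ring.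
Qed.

Lemma Cmod_vline (x y y' : R) : Cmod ((x, y') - (x, y)) = Rabs (y' - y).
Proof.
  replace ((x, y') - (x, y))%C with (Ci * RtoC (y' - y))%C.
  - rewrite Cmod_mult, Cmod_Ci, Cmod_R. ring.
  - unfold Cminus, Cplus, Copp, Cmult, Ci, RtoC; simpl. f_equal; ring.
Qed.

Lemma cont_hline (K : C -> C) (y t : R) :
  cont K (t, y) -> tends (locally t) (fun x => K (x, y)) (K (t, y)).
Proof.
  intros H eps He. destruct (proj1 (locally_Cmod _ _) (H eps He)) as (d & d0 & Hd).
  exists (mkposreal d d0). intros x Hx. apply Hd. rewrite Cmod_hline. exact Hx.
Qed.

Lemma cont_vline (K : C -> C) (x t : R) :
  cont K (x, t) -> tends (locally t) (fun y => K (x, y)) (K (x, t)).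
Proof.
  intros H eps He. destruct (proj1 (locally_Cmod _ _) (H eps He)) as (d & d0 & Hd).
  exists (mkposreal d d0). intros y Hy. apply Hd. rewrite Cmod_vline. exact Hy.
Qed.

(** This is the integral of [K] dz counterclockwise around the boundary. Opposite sides share one
    integral, so that whatever agrees on both cancels pointwise. *)
Definition rect_int (K : C -> C) (x1 x2 y1 y2 : R) : C :=
  (CInt (fun x => K (x, y1) - K (x, y2)) x1 x2
   + Ci * CInt (fun y => K (x2, y) - K (x1, y)) y1 y2)%C.

Definition in_rect (x1 x2 y1 y2 : R) (z : C) : Prop :=
  x1 <= fst z <= x2 /\ y1 <= snd z <= y2.

Lemma path_h (K : C -> C) (x1 x2 y1 y2 y : R) :
  (forall z, in_rect x1 x2 y1 y2 z -> cont K z) -> y1 <= y <= y2 ->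
  path_cont (fun x => K (x, y)) x1 x2.
Proof. intros H Hy t Ht. apply cont_hline, H. split; simpl; lra. Qed.

Lemma path_v (K : C -> C) (x1 x2 y1 y2 x : R) :
  (forall z, in_rect x1 x2 y1 y2 z -> cont K z) -> x1 <= x <= x2 ->
  path_cont (fun y => K (x, y)) y1 y2.
Proof. intros H Hx t Ht. apply cont_vline, H. split; simpl; lra. Qed.

Lemma path_minus (f g : R -> C) (a b : R) :
  path_cont f a b -> path_cont g a b -> path_cont (fun t => f t - g t)%C a b.
Proof. intros Hf Hg t Ht. apply (tends_minus (locally t) f g); auto. Qed.

Lemma rect_int_split_x (K : C -> C) (x1 x x2 y1 y2 : R) :
  x1 <= x <= x2 -> y1 <= y2 -> (forall z, in_rect x1 x2 y1 y2 z -> cont K z) ->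
  rect_int K x1 x2 y1 y2 = (rect_int K x1 x y1 y2 + rect_int K x x2 y1 y2)%C.
Proof.
  intros Hx Hy H. unfold rect_int.
  rewrite (CInt_chasles _ x1 x x2); try lra.
  2: { apply path_minus; eapply path_h; eauto; lra. }
  rewrite !(CInt_minus (fun y => K (_, y))); try lra; try (eapply path_v; eauto; lra).
  ring.
Qed.

Lemma rect_int_split_y (K : C -> C) (x1 x2 y1 y y2 : R) :
  x1 <= x2 -> y1 <= y <= y2 -> (forall z, in_rect x1 x2 y1 y2 z -> cont K z) ->
  rect_int K x1 x2 y1 y2 = (rect_int K x1 x2 y1 y + rect_int K x1 x2 y y2)%C.
Proof.
  intros Hx Hy H. unfold rect_int.
  rewrite (CInt_chasles (fun y0 => _) y1 y y2); try lra.
  2: { apply path_minus; eapply path_v; eauto; lra. }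
  rewrite !(CInt_minus (fun x => K (x, _))); try lra; try (eapply path_h; eauto; lra).
  ring.
Qed.

(* The integrand of [rect_int] is a difference, so the affine part of [K] contributes zero. *)
Lemma rect_int_local (K : C -> C) (x1 x2 y1 y2 : R) (c l z0 : C) (e : R) :
  x1 <= x2 -> y1 <= y2 -> (forall z, in_rect x1 x2 y1 y2 z -> cont K z) ->
  (forall z, in_rect x1 x2 y1 y2 z -> Cmod (K z - c - l * (z - z0)) <= e) ->
  Cmod (rect_int K x1 x2 y1 y2) <= 2 * e * ((x2 - x1) + (y2 - y1)).
Proof.
  intros Hx Hy H He.
  assert (P1 : path_cont (fun x => K (x, y1) - K (x, y2))%C x1 x2)
    by (apply path_minus; eapply path_h; eauto; lra).
  assert (P2 : path_cont (fun y => K (x2, y) - K (x1, y))%C y1 y2)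
    by (apply path_minus; eapply path_v; eauto; lra).
  assert (PC : forall c a b, path_cont (fun _ => c) a b)
    by (intros c' a b t _; apply tends_const; typeclasses eauto).
  (* [A] and [B] are the constant differences of [l * z] across the two pairs of sides. Since A (x2
     - x1) + i B (y2 - y1) = 0, subtracting them leaves the integral unchanged. *)
  set (A := (l * (Ci * (y1 - y2)%R))%C). set (B := (l * (x2 - x1)%R)%C).
  assert (E : rect_int K x1 x2 y1 y2 =
    (CInt (fun x => K (x, y1) - K (x, y2) - A) x1 x2
     + Ci * CInt (fun y => K (x2, y) - K (x1, y) - B) y1 y2)%C).
  { unfold rect_int. rewrite (CInt_minus _ (fun _ => A)), (CInt_minus _ (fun _ => B)); auto.
    rewrite !CInt_const. unfold A, B. rewrite !RtoC_minus. ring. }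
  rewrite E. eapply Rle_trans; [apply Cmod_triangle|].
  rewrite Cmod_mult, Cmod_Ci, Rmult_1_l.
  assert (X : Cmod (CInt (fun x => K (x, y1) - K (x, y2) - A)%C x1 x2) <= (x2 - x1) * (2 * e)).
  { apply CInt_bound; [lra|apply path_minus; auto|]. intros t Ht.
    replace (K (t, y1) - K (t, y2) - A)%C with
      ((K (t, y1) - c - l * ((t, y1) - z0)) - (K (t, y2) - c - l * ((t, y2) - z0)))%C.
    - eapply Rle_trans; [apply Cmod_triangle|]. rewrite Cmod_opp.
      assert (Q1 := He (t, y1)). assert (Q2 := He (t, y2)).
      assert (in_rect x1 x2 y1 y2 (t, y1)) by (split; simpl; lra).
      assert (in_rect x1 x2 y1 y2 (t, y2)) by (split; simpl; lra).
      specialize (Q1 H0). specialize (Q2 H1). lra.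
    - unfold A. replace (Ci * (y1 - y2)%R)%C with ((t, y1) - (t, y2))%C; [ring|].
      unfold Cminus, Cplus, Copp, Cmult, Ci, RtoC; simpl. f_equal; ring. }
  assert (Y : Cmod (CInt (fun y => K (x2, y) - K (x1, y) - B)%C y1 y2) <= (y2 - y1) * (2 * e)).
  { apply CInt_bound; [lra|apply path_minus; auto|]. intros t Ht.
    replace (K (x2, t) - K (x1, t) - B)%C with
      ((K (x2, t) - c - l * ((x2, t) - z0)) - (K (x1, t) - c - l * ((x1, t) - z0)))%C.
    - eapply Rle_trans; [apply Cmod_triangle|]. rewrite Cmod_opp.
      assert (Q1 := He (x2, t)). assert (Q2 := He (x1, t)).
      assert (in_rect x1 x2 y1 y2 (x2, t)) by (split; simpl; lra).
      assert (in_rect x1 x2 y1 y2 (x1, t)) by (split; simpl; lra).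
      specialize (Q1 H0). specialize (Q2 H1). lra.
    - unfold B. replace (RtoC (x2 - x1)%R)%C with ((x2, t) - (x1, t))%C; [ring|].
      unfold Cminus, Cplus, Copp, Cmult, Ci, RtoC; simpl. f_equal; ring. }
  lra.
Qed.

(** * Goursat's theorem by bisection *)

Lemma nested_intervals (u v : nat -> R) :
  (forall n, u n <= u (S n)) -> (forall n, v (S n) <= v n) -> (forall n, u n <= v n) ->
  exists X, forall n, u n <= X <= v n.
Proof.
  intros Hu Hv Huv.
  assert (Iu : forall n m, (n <= m)%nat -> u n <= u m).
  { induction 1; [lra|]. eapply Rle_trans; eauto. }
  assert (Iv : forall n m, (n <= m)%nat -> v m <= v n).
  { induction 1; [lra|]. eapply Rle_trans; eauto. }
  assert (C0 : forall n m, u n <= v m).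
  { intros n m. destruct (Nat.le_ge_cases n m) as [L|L].
    - apply Rle_trans with (u m); auto.
    - apply Rle_trans with (v n); auto. }
  destruct (completeness (fun x => exists n, x = u n)) as [X [H1 H2]].
  - exists (v 0%nat). intros x [n ->]. apply C0.
  - exists (u 0%nat). now exists 0%nat.
  - exists X. intros n. split.
    + apply H1. now exists n.
    + apply H2. intros x [m ->]. apply C0.
Qed.

Lemma pow_half_pos (n : nat) : 0 < (/ 2) ^ n.
Proof. apply pow_lt. lra. Qed.

Lemma pow_half_small (M d : R) : 0 < d -> exists n, (/ 2) ^ n * M < d.
Proof.
  intros d0. assert (P : 0 < d / (Rabs M + 1)).
  { apply Rdiv_lt_0_compat; auto. assert (A := Rabs_pos M). lra. }
  destruct (pow_lt_1_zero (/ 2) ltac:(rewrite Rabs_pos_eq; lra) _ P) as [N HN].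
  exists N. specialize (HN N (le_n _)). rewrite Rabs_pos_eq in HN by (left; apply pow_half_pos).
  assert (Q := pow_half_pos N). assert (A := Rabs_pos M). assert (B := Rle_abs M).
  apply Rle_lt_trans with ((/ 2) ^ N * (Rabs M + 1)); [nra|].
  replace d with (d / (Rabs M + 1) * (Rabs M + 1)) by (field; lra).
  apply Rmult_lt_compat_r; [lra|exact HN].
Qed.

Section Bisection.
Variables (K : C -> C) (x1 y1 w h D : R).
Hypothesis w0 : 0 <= w.
Hypothesis h0 : 0 <= h.
Hypothesis HK : forall z, in_rect x1 (x1 + w) y1 (y1 + h) z -> cont K z.

Definition piece (n : nat) (p : R * R) : C :=
  rect_int K (fst p) (fst p + (/ 2) ^ n * w) (snd p) (snd p + (/ 2) ^ n * h).

(** After [n] quarterings a heavy rectangle has kept its fair share D / 4^n of the integral. Its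
    sides are the original ones scaled by 2^-n, so the corner [p] determines it. *)
Definition heavy (n : nat) (p : R * R) : Prop :=
  x1 <= fst p /\ fst p + (/ 2) ^ n * w <= x1 + w /\
  y1 <= snd p /\ snd p + (/ 2) ^ n * h <= y1 + h /\
  D * ((/ 2) ^ n) ^ 2 <= Cmod (piece n p).

(** The integrals over the four quarters add up to the integral over the whole, so they cannot all
    fall below a quarter of its modulus. Heaviness is assumed inside the existential, so that a
    successor can be chosen for every corner and [heavy_seq] recurses on corners alone. *)
Lemma heavy_step (n : nat) (p : R * R) :
  exists q : R * R, heavy n p -> heavy (S n) q /\
    fst p <= fst q /\ fst q + (/ 2) ^ (S n) * w <= fst p + (/ 2) ^ n * w /\
    snd p <= snd q /\ snd q + (/ 2) ^ (S n) * h <= snd p + (/ 2) ^ n * h.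
Proof.
  destruct (classic (heavy n p)) as [H|N]; [|exists p; tauto].
  destruct p as [x y]. destruct H as (A1 & A2 & A3 & A4 & A5). unfold piece in A5. simpl fst in *; simpl snd in *.
  set (a := (/ 2) ^ n * w) in *. set (b := (/ 2) ^ n * h) in *.
  assert (L := pow_half_pos n).
  assert (a0 : 0 <= a) by (unfold a; nra). assert (b0 : 0 <= b) by (unfold b; nra).
  assert (Ea : (/ 2) ^ (S n) * w = a / 2) by (unfold a; simpl; field).
  assert (Eb : (/ 2) ^ (S n) * h = b / 2) by (unfold b; simpl; field).
  assert (HK' : forall z, in_rect x (x + a) y (y + b) z -> cont K z).
  { intros z [U V]. apply HK. split; lra. }
  rewrite (rect_int_split_x K x (x + a / 2) (x + a) y (y + b)) in A5; try lra; auto.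
  rewrite !(rect_int_split_y K _ _ y (y + b / 2) (y + b)) in A5; try lra;
    try (intros z [U V]; apply HK'; split; lra).
  assert (G : forall q : R * R, (fst q = x \/ fst q = x + a / 2) -> (snd q = y \/ snd q = y + b / 2) ->
     D * ((/ 2) ^ (S n)) ^ 2 <= Cmod (rect_int K (fst q) (fst q + a / 2) (snd q) (snd q + b / 2)) ->
     exists q : R * R, heavy n (x, y) -> heavy (S n) q /\
    x <= fst q /\ fst q + a / 2 <= x + a /\
    y <= snd q /\ snd q + b / 2 <= y + b).
  { intros q [Q1|Q1] [Q2|Q2] HQ; exists q; intros _; unfold heavy, piece;
      rewrite Ea, Eb; (split; [split; [|split; [|split; [|split]]]|]; try lra; exact HQ). }
  rewrite Ea, Eb.
  apply NNPP; intro N.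
  assert (B : forall q : R * R, (fst q = x \/ fst q = x + a / 2) -> (snd q = y \/ snd q = y + b / 2) ->
     Cmod (rect_int K (fst q) (fst q + a / 2) (snd q) (snd q + b / 2)) < D * ((/ 2) ^ (S n)) ^ 2).
  { intros q Q1 Q2. apply Rnot_le_lt. intro C0. apply N. eapply G; eauto. }
  assert (B1 := B (x, y) (or_introl eq_refl) (or_introl eq_refl)).
  assert (B2 := B (x + a / 2, y) (or_intror eq_refl) (or_introl eq_refl)).
  assert (B3 := B (x, y + b / 2) (or_introl eq_refl) (or_intror eq_refl)).
  assert (B4 := B (x + a / 2, y + b / 2) (or_intror eq_refl) (or_intror eq_refl)).
  simpl fst in *; simpl snd in *.
  replace (x + a / 2 + a / 2) with (x + a) in * by lra.
  replace (y + b / 2 + b / 2) with (y + b) in * by lra.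
  simpl in B1, B2, B3, B4, A5.
  match goal with H : _ <= Cmod (?p + ?q + (?r + ?s)) |- _ =>
    assert (T1 := Cmod_triangle (p + q) (r + s)); assert (T2 := Cmod_triangle p q);
    assert (T3 := Cmod_triangle r s) end.
  lra.
Qed.

Definition heavy_next (n : nat) (p : R * R) : R * R :=
  proj1_sig (constructive_indefinite_description _ (heavy_step n p)).

Fixpoint heavy_seq (n : nat) : R * R :=
  match n with O => (x1, y1) | S m => heavy_next m (heavy_seq m) end.

Lemma heavy_limit :
  D <= Cmod (rect_int K x1 (x1 + w) y1 (y1 + h)) ->
  exists z, in_rect x1 (x1 + w) y1 (y1 + h) z /\
    forall n, exists p, heavy n p /\ in_rect (fst p) (fst p + (/ 2) ^ n * w) (snd p) (snd p + (/ 2) ^ n * h) z.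
Proof.
  intros HD.
  assert (H : forall n, heavy n (heavy_seq n)).
  { induction n.
    - unfold heavy, piece. simpl. rewrite !Rmult_1_l. repeat split; lra.
    - apply (proj2_sig (constructive_indefinite_description _ (heavy_step n (heavy_seq n)))), IHn. }
  assert (S1 := fun n => proj2 (proj2_sig (constructive_indefinite_description _ (heavy_step n (heavy_seq n))) (H n))).
  assert (L := pow_half_pos).
  destruct (nested_intervals (fun n => fst (heavy_seq n)) (fun n => fst (heavy_seq n) + (/ 2) ^ n * w)) as [X HX].
  - intros n. apply S1.
  - intros n. apply S1.
  - intros n. specialize (L n). nra.
  - destruct (nested_intervals (fun n => snd (heavy_seq n)) (fun n => snd (heavy_seq n) + (/ 2) ^ n * h)) as [Y HY].
    + intros n. apply S1.
    + intros n. apply S1.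
    + intros n. specialize (L n). nra.
    + exists (X, Y). split.
      * specialize (HX 0%nat). specialize (HY 0%nat). simpl in HX, HY. split; simpl; lra.
      * intros n. exists (heavy_seq n). split; [apply H|]. split; [apply HX|apply HY].
Qed.

End Bisection.

Lemma goursat (K : C -> C) (x1 x2 y1 y2 : R) :
  x1 <= x2 -> y1 <= y2 -> (forall z, in_rect x1 x2 y1 y2 z -> cdiff K z) ->
  rect_int K x1 x2 y1 y2 = 0.
Proof.
  intros Hx Hy HK. apply NNPP; intro N. apply Cmod_gt_0 in N.
  set (D := Cmod (rect_int K x1 x2 y1 y2)) in N.
  assert (Ex : exists w, x2 = x1 + w) by (exists (x2 - x1); lra). destruct Ex as [w ->].
  assert (Ey : exists h, y2 = y1 + h) by (exists (y2 - y1); lra). destruct Ey as [h ->].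
  assert (HC : forall z, in_rect x1 (x1 + w) y1 (y1 + h) z -> cont K z) by (intros; apply cdiff_cont; auto).
  destruct (heavy_limit K x1 y1 w h D ltac:(lra) ltac:(lra) HC (Rle_refl _)) as (z & Hz & Hn).
  destruct (HK z Hz) as (phi & Hphi & E).
  set (s := w + h). assert (s0 : 0 <= s) by (unfold s; lra).
  (* At scale [t] a heavy rectangle has an integral of modulus at least D t^2, while approximating
     [K] by its affine part up to e t s bounds it by 2 e s^2 t^2. This [e] satisfies 4 e (s^2 + 1) =
     D, which makes the two incompatible. *)
  set (e := D / (4 * (s * s + 1))).
  assert (e0 : 0 < e) by (apply Rdiv_lt_0_compat; [lra|nra]).
  destruct (proj1 (locally_Cmod _ _) (Hphi e e0)) as (d & d0 & Hd).
  destruct (pow_half_small s d d0) as [n Hs].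
  destruct (Hn n) as (p & (A1 & A2 & A3 & A4 & A5) & [B1 B2]).
  assert (L := pow_half_pos n). set (t := (/ 2) ^ n) in *.
  assert (Q : Cmod (piece K w h n p) <= 2 * (e * (t * s)) * (t * s)).
  { unfold piece. fold t. replace (t * s) with ((fst p + t * w - fst p) + (snd p + t * h - snd p)) at 2 by (unfold s; ring).
    apply (rect_int_local K _ _ _ _ (K z) (phi z) z); try nra.
    - intros v [V1 V2]. apply HC. split; lra.
    - intros v [V1 V2]. rewrite E.
      replace (phi v * (v - z) - phi z * (v - z))%C with ((phi v - phi z) * (v - z))%C by ring.
      assert (M : Cmod (v - z) <= t * s).
      { destruct v as [v1 v2], z as [z1 z2]. simpl in *.
        eapply Rle_trans; [apply Cmod_pair_le|]. simpl. unfold s.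
        assert (Rabs (v1 + - z1) <= t * w) by (apply Rabs_le; lra).
        assert (Rabs (v2 + - z2) <= t * h) by (apply Rabs_le; lra). lra. }
      rewrite Cmod_mult. apply Rmult_le_compat; try apply Cmod_ge_0; auto.
      left. apply Hd. lra. }
  assert (R1 : D * (t * t) <= (2 * e * (s * s)) * (t * t)).
  { fold t in A5. eapply Rle_trans; [|eapply Rle_trans; [apply Q|]]; [|lra]. simpl in A5. lra. }
  apply Rmult_le_reg_r in R1; [|nra].
  assert (e * (4 * (s * s + 1)) = D) by (unfold e; field; nra).
  nra.
Qed.

(** * Subsequences and circle integrals *)

Definition strict_incr (s : nat -> nat) : Prop := forall k, (s k < s (S k))%nat.

Lemma strict_incr_ge (s : nat -> nat) : strict_incr s -> forall k, (k <= s k)%nat.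
Proof. intros H k. induction k; [lia|]. specialize (H k). lia. Qed.

Lemma strict_incr_lt (s : nat -> nat) : strict_incr s -> forall j k, (j < k)%nat -> (s j < s k)%nat.
Proof. intros H j k L. induction L; [apply H|]. specialize (H m). lia. Qed.

Lemma strict_incr_comp (s t : nat -> nat) :
  strict_incr s -> strict_incr t -> strict_incr (fun k => s (t k)).
Proof. intros Hs Ht k. apply strict_incr_lt; auto. Qed.

Lemma eventually_and (P Q : nat -> Prop) :
  eventually P -> eventually Q -> eventually (fun k => P k /\ Q k).
Proof. apply (filter_and (F := eventually)). Qed.

Lemma tends_subseq (u : nat -> C) (s : nat -> nat) (l : C) :
  strict_incr s -> tends eventually u l -> tends eventually (fun k => u (s k)) l.
Proof. intros Hs Hu eps He. exact (eventually_subseq s Hs (fun k => Cmod (u k - l) < eps) (Hu eps He)). Qed.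

Lemma extract_subseq (P : nat -> nat -> Prop) :
  (forall j N, exists p, (N <= p)%nat /\ P j p) ->
  exists s, strict_incr s /\ forall j, P j (s j).
Proof.
  intros H.
  set (c := fun j N => constructive_indefinite_description _ (H j N)).
  set (s := fix s k := match k with O => proj1_sig (c O O) | S m => proj1_sig (c (S m) (S (s m))) end).
  exists s. split.
  - intros k. simpl. destruct (c (S k) (S (s k))) as [p [Hp Hp2]]. simpl. lia.
  - intros [|j]; simpl; [destruct (c O O) as [p [Hp1 Hp]]|destruct (c (S j) (S (s j))) as [p [Hp1 Hp]]]; exact Hp.
Qed.

Lemma inv_INR_small (eps : R) : 0 < eps -> eventually (fun k => / (INR k + 1) < eps).
Proof.
  intros He. destruct (archimed_cor1 eps He) as (N & HN & N0). exists N. intros k Hk.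
  apply Rle_lt_trans with (/ INR N); auto. apply Rinv_le_contravar.
  - now apply lt_0_INR.
  - apply le_INR in Hk. lra.
Qed.

Lemma bolzano_R (x : nat -> R) (M : R) :
  (forall k, Rabs (x k) <= M) ->
  exists s l, strict_incr s /\ forall eps, 0 < eps -> eventually (fun k => Rabs (x (s k) - l) < eps).
Proof.
  intros HM.
  destruct (Bolzano_Weierstrass x (fun t => - M <= t <= M) (compact_P3 (- M) M)) as [l Hl].
  - intros n. apply Rabs_le_between, HM.
  - destruct (extract_subseq (fun j p => Rabs (x p - l) < / (INR j + 1))) as [s [Hs Hs2]].
    + intros j N.
      assert (P : 0 < / (INR j + 1)) by (apply Rinv_0_lt_compat; assert (A := pos_INR j); lra).
      destruct (Hl (disc l (mkposreal _ P)) N) as [p [Hp Hp2]].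
      * exists (mkposreal _ P). intros t Ht. exact Ht.
      * exists p. split; [exact Hp|exact Hp2].
    + exists s, l. split; [auto|]. intros eps He.
      generalize (inv_INR_small eps He). apply filter_imp. intros k Hk.
      eapply Rlt_trans; [apply Hs2|exact Hk].
Qed.

Lemma bolzano_C (u : nat -> C) (M : R) :
  (forall k, Cmod (u k) <= M) -> exists s l, strict_incr s /\ tends eventually (fun k => u (s k)) l.
Proof.
  intros HM.
  assert (B := fun k => Rmax_Cmod (u k)).
  destruct (bolzano_R (fun k => fst (u k)) M) as (s & a & Hs & Ha).
  { intros k. eapply Rle_trans; [|apply HM]. eapply Rle_trans; [|apply B]. apply Rmax_l. }
  destruct (bolzano_R (fun k => snd (u (s k))) M) as (t & b & Ht & Hb).
  { intros k. eapply Rle_trans; [|apply HM]. eapply Rle_trans; [|apply B]. apply Rmax_r. }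
  exists (fun k => s (t k)), (a, b). split; [apply strict_incr_comp; auto|].
  intros eps He.
  generalize (eventually_and _ _ (eventually_subseq t Ht _ (Ha (eps / 2) ltac:(lra))) (Hb (eps / 2) ltac:(lra))).
  apply filter_imp. intros k [H1 H2].
  eapply Rle_lt_trans; [|replace eps with (eps / 2 + eps / 2) by lra; apply Rplus_lt_compat; [apply H1|apply H2]].
  destruct (u (s (t k))) as [x y]. apply Cmod_pair_le.
Qed.

Lemma tends_cont (f : C -> C) (u : nat -> C) (l : C) :
  cont f l -> tends eventually u l -> tends eventually (fun k => f (u k)) (f l).
Proof.
  intros Hf Hu eps He. destruct (proj1 (locally_Cmod _ _) (Hf eps He)) as (d & d0 & Hd).
  generalize (Hu d d0). apply filter_imp. intros k Hk. apply Hd, Hk.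
Qed.

(** * The complex exponential and integrals over circles *)

Definition cis (t : R) : C := (cos t, sin t).

Lemma Cmod_cis (t : R) : Cmod (cis t) = 1.
Proof.
  unfold Cmod, cis. simpl. rewrite !Rmult_1_r.
  assert (E := sin2_cos2 t). unfold Rsqr in E. rewrite Rplus_comm, E. apply sqrt_1.
Qed.

Definition cexp (w : C) : C := (RtoC (exp (fst w)) * cis (snd w))%C.

Lemma cexp_plus (w h : C) : cexp (w + h) = (cexp w * cexp h)%C.
Proof.
  destruct w as [a b], h as [c d]. unfold cexp, cis, Cplus, Cmult, RtoC. simpl.
  rewrite exp_plus, cos_plus, sin_plus. f_equal; ring.
Qed.

Lemma cexp_0 : cexp 0 = 1.
Proof.
  unfold cexp, cis, Cmult, RtoC. simpl. rewrite exp_0, cos_0, sin_0. f_equal; ring.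
Qed.

Lemma is_derive_eps (f : R -> R) (x l : R) : is_derive f x l ->
  forall eps, 0 < eps -> exists d, 0 < d /\ forall y, Rabs (y - x) < d ->
    Rabs (f y - f x - (y - x) * l) <= eps * Rabs (y - x).
Proof.
  intros [_ H] eps He. destruct (H x (fun P HP => HP) (mkposreal _ He)) as [d Hd].
  exists d. split; [apply cond_pos|]. intros y Hy. exact (Hd y Hy).
Qed.

Lemma cdiff_cexp_0 : cdiff cexp 0.
Proof.
  apply (cdiff_intro cexp 0 1). intros eps He.
  (* The four error terms below are at most e|x|, 3e|y|, 2e|w| and 3e|y|, in all 9e|w|. The radius
     is also kept below [e], which gives |y| <= e in the product (exp x - 1) y. *)
  set (e := Rmin 1 (eps / 16)).
  assert (e0 : 0 < e) by (apply Rmin_pos; lra).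
  assert (e1 : e <= 1) by apply Rmin_l. assert (e2 : e <= eps / 16) by apply Rmin_r.
  destruct (is_derive_eps exp 0 1 ltac:(auto_derive; auto; rewrite exp_0; ring) e e0) as (d1 & D1 & H1).
  destruct (is_derive_eps cos 0 0 ltac:(auto_derive; auto; rewrite sin_0; ring) e e0) as (d2 & D2 & H2).
  destruct (is_derive_eps sin 0 1 ltac:(auto_derive; auto; rewrite cos_0; ring) e e0) as (d3 & D3 & H3).
  exists (Rmin (Rmin d1 d2) (Rmin d3 e)). split; [apply Rmin_pos; apply Rmin_pos; assumption|].
  intros w Hw. rewrite cexp_0. replace (w - 0)%C with w in * by ring.
  destruct w as [x y].
  assert (R1 := Rle_trans _ _ _ (Rmax_l _ _) (Rmax_Cmod (x, y))). 
  assert (R2 := Rle_trans _ _ _ (Rmax_r _ _) (Rmax_Cmod (x, y))). simpl in R1, R2.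
  set (m := Cmod (x, y)) in *.
  assert (M1 := Rmin_l (Rmin d1 d2) (Rmin d3 e)). assert (M2 := Rmin_r (Rmin d1 d2) (Rmin d3 e)).
  assert (M3 := Rmin_l d1 d2). assert (M4 := Rmin_r d1 d2). assert (M5 := Rmin_l d3 e). assert (M6 := Rmin_r d3 e).
  specialize (H1 x ltac:(rewrite Rminus_0_r; lra)). specialize (H2 y ltac:(rewrite Rminus_0_r; lra)).
  specialize (H3 y ltac:(rewrite Rminus_0_r; lra)).
  rewrite exp_0 in H1. rewrite cos_0 in H2. rewrite sin_0 in H3.
  rewrite Rminus_0_r in H1, H2, H3. rewrite Rmult_1_r in H1, H3. rewrite Rmult_0_r, Rminus_0_r in H2. rewrite Rminus_0_r in H3.
  assert (A0 := Rabs_pos x). assert (B0 := Rabs_pos y).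
  replace (cexp (x, y) - 1 - 1 * (x, y))%C with
    ((exp x - 1 - x) + exp x * (cos y - 1), (exp x - 1) * y + exp x * (sin y - y)).
  2: { unfold cexp, cis, Cminus, Cplus, Copp, Cmult, RtoC. simpl. f_equal; ring. }
  assert (Ex : Rabs (exp x - 1) <= 2 * Rabs x).
  { replace (exp x - 1) with ((exp x - 1 - x) + x) by ring. eapply Rle_trans; [apply Rabs_triang|]. nra. }
  assert (Ex2 : Rabs (exp x) <= 3).
  { replace (exp x) with ((exp x - 1) + 1) by ring. eapply Rle_trans; [apply Rabs_triang|]. rewrite Rabs_R1. lra. }
  assert (Ex0 := Rabs_pos (exp x)).
  eapply Rle_trans; [apply Cmod_pair_le|].
  eapply Rle_trans; [apply Rplus_le_compat; apply Rabs_triang|].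
  rewrite !Rabs_mult.
  assert (Rabs (exp x) * Rabs (cos y - 1) <= 3 * (e * Rabs y)) by (apply Rmult_le_compat; auto; apply Rabs_pos).
  assert (Rabs (exp x) * Rabs (sin y - y) <= 3 * (e * Rabs y)) by (apply Rmult_le_compat; auto; apply Rabs_pos).
  assert (Rabs (exp x - 1) * Rabs y <= (2 * m) * e).
  { apply Rmult_le_compat; auto; try apply Rabs_pos; lra. }
  assert (e * Rabs x <= e * m) by (apply Rmult_le_compat_l; lra).
  assert (e * Rabs y <= e * m) by (apply Rmult_le_compat_l; lra).
  assert (0 <= m) by lra.
  assert (e * m <= eps / 16 * m) by (apply Rmult_le_compat_r; lra).
  assert (0 <= eps * m) by (apply Rmult_le_pos; lra). lra.
Qed.

Lemma cdiff_cexp (w : C) : cdiff cexp w.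
Proof.
  destruct cdiff_cexp_0 as (phi & Hphi & E).
  exists (fun v => cexp w * phi (v - w))%C. split.
  - apply (cont_mult (fun _ => cexp w) (fun v => phi (v - w))%C); [apply cont_const|].
    apply (cont_comp phi (fun v => v - w)%C).
    + apply cont_minus; [apply cont_id|apply cont_const].
    + replace (w - w)%C with (RtoC 0) by ring. exact Hphi.
  - intros v. replace v with (w + (v - w))%C at 1 by ring. rewrite cexp_plus.
    specialize (E (v - w)%C). rewrite cexp_0 in E.
    replace (cexp (v - w)) with ((cexp (v - w) - 1) + 1)%C by ring. rewrite E. ring.
Qed.

(** The integral is taken in the angle, so it equals -i times the contour integral of f(z) / (z -
    z0). Hence Cauchy's kernel takes the form (z - z0) / (z - zeta), and radius 0 makes sense. *)
Definition circ (f : C -> C) (z0 : C) (r : R) : C :=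
  CInt (fun t => f (z0 + RtoC r * cis t)%C) 0 (2 * PI).

Definition on_circle (z0 : C) (r : R) (z : C) : Prop := Cmod (z - z0) = r.

Lemma on_circle_cis (z0 : C) (r t : R) : 0 <= r -> on_circle z0 r (z0 + RtoC r * cis t)%C.
Proof.
  intros r0. unfold on_circle. replace (z0 + RtoC r * cis t - z0)%C with (RtoC r * cis t)%C by ring.
  rewrite Cmod_mult, Cmod_cis, Cmod_R, Rabs_pos_eq; lra.
Qed.

Lemma cis_tends (t : R) : tends (locally t) cis (cis t).
Proof.
  replace cis with (fun y => cexp (0, y)).
  - replace (cis t) with (cexp (0, t)).
    + apply (cont_vline cexp 0 t), cdiff_cont, cdiff_cexp.
    + unfold cexp. simpl. rewrite exp_0. ring.
  - apply functional_extensionality. intros y. unfold cexp. simpl. rewrite exp_0. ring.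
Qed.

Lemma circ_path (f : C -> C) (z0 : C) (r : R) : 0 <= r ->
  (forall z, on_circle z0 r z -> cont f z) ->
  path_cont (fun t => f (z0 + RtoC r * cis t)%C) 0 (2 * PI).
Proof.
  intros r0 H t _ eps He.
  destruct (proj1 (locally_Cmod _ _) (H _ (on_circle_cis z0 r t r0) eps He)) as (d & d0 & Hd).
  assert (T : tends (locally t) (fun y => z0 + RtoC r * cis y)%C (z0 + RtoC r * cis t)%C).
  { apply (tends_plus (locally t) (fun _ => z0)); [apply tends_const; typeclasses eauto|].
    apply (tends_mult (locally t) (fun _ => RtoC r)); [apply tends_const; typeclasses eauto|apply cis_tends]. }
  generalize (T d d0). apply filter_imp. intros y Hy. apply Hd, Hy.
Qed.

(* In the coordinate [z = z0 + exp w] an annulus becomes a rectangle, and the two horizontal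
   sides of the rectangle cancel by periodicity. *)
Lemma circ_annulus (f : C -> C) (z0 : C) (r1 r2 : R) :
  0 < r1 <= r2 -> (forall z, r1 <= Cmod (z - z0) <= r2 -> cdiff f z) ->
  circ f z0 r1 = circ f z0 r2.
Proof.
  intros Hr Hf. set (K := fun w => f (z0 + cexp w)%C).
  assert (PP := PI_RGT_0).
  assert (HK : forall w, in_rect (ln r1) (ln r2) 0 (2 * PI) w -> cdiff K w).
  { intros w [W1 W2]. apply (cdiff_comp f (fun w => z0 + cexp w)%C).
    - destruct (cdiff_cexp w) as (phi & P1 & P2). exists phi. split; [auto|].
      intros v. rewrite <- P2. ring.
    - apply Hf. replace (z0 + cexp w - z0)%C with (cexp w) by ring.
      unfold cexp. rewrite Cmod_mult, Cmod_cis, Cmod_R, Rmult_1_r, Rabs_pos_eq by (left; apply exp_pos).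
      rewrite <- (exp_ln r1), <- (exp_ln r2) by lra.
      split; destruct W1 as [[L1|L1] [L2|L2]];
       solve [left; apply exp_increasing; assumption | right; congruence | rewrite L1; lra | rewrite L2; lra]. }
  assert (L : ln r1 <= ln r2).
  { destruct (proj2 Hr) as [L|L]; [left; apply ln_increasing; lra|rewrite L; lra]. }
  assert (G := goursat K (ln r1) (ln r2) 0 (2 * PI) L ltac:(lra) HK).
  assert (HC : forall w, in_rect (ln r1) (ln r2) 0 (2 * PI) w -> cont K w) by (intros; apply cdiff_cont; auto).
  unfold rect_int in G.
  rewrite (CInt_ext _ (fun _ => RtoC 0)) in G.
  2: lra.
  2: { intros x _. unfold K. replace (cexp (x, 2 * PI)) with (cexp (x, 0)); [ring|].
       unfold cexp, cis. simpl. now rewrite cos_2PI, sin_2PI, cos_0, sin_0. }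
  rewrite CInt_const, CInt_minus in G; try lra; try (eapply path_v; eauto; lra).
  assert (E : forall r, 0 < r -> CInt (fun y => K (ln r, y)) 0 (2 * PI) = circ f z0 r).
  { intros r r0. apply CInt_ext; [lra|]. intros t _. unfold K, cexp. simpl. now rewrite exp_ln. }
  rewrite !E in G by lra.
  assert (G2 : (circ f z0 r2 - circ f z0 r1)%C = 0).
  { replace (circ f z0 r2 - circ f z0 r1)%C with (- Ci * (((ln r2 - ln r1)%R * 0) + Ci * (circ f z0 r2 - circ f z0 r1)))%C.
    - rewrite G. ring.
    - transitivity (- (Ci * Ci) * (circ f z0 r2 - circ f z0 r1))%C; [ring|].
      replace (- (Ci * Ci))%C with (RtoC 1); [ring|]. unfold Cmult, Ci, Copp, RtoC. simpl. f_equal; ring. }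
  symmetry. apply Cminus_eq_0, G2.
Qed.

(** Compactness of the unit circle takes the place of uniform continuity. If the integrals stayed
    [eps] apart along a subsequence, then at some angles the integrands would differ by at least
    [e], where 2 PI e = eps / 2. The angles may be unbounded, so it is their images under [cis] that
    are made to converge; continuity at the limit point gives the contradiction. *)
Lemma circ_continuous (f : C -> C) (z0 : C) (r : R) (rho : nat -> R) (R0 : R) :
  0 <= r -> (forall k, 0 <= rho k <= R0) -> r <= R0 ->
  (forall z, Cmod (z - z0) <= R0 -> cont f z) ->
  (forall eps, 0 < eps -> eventually (fun k => Rabs (rho k - r) < eps)) ->
  tends eventually (fun k => circ f z0 (rho k)) (circ f z0 r).
Proof.
  intros r0 Hrho rR Hf Hlim eps He. apply NNPP; intro N.
  assert (PP := PI_RGT_0).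
  set (e := eps / (4 * PI)). assert (e0 : 0 < e) by (apply Rdiv_lt_0_compat; lra).
  assert (Bad : forall k, exists t, eps <= Cmod (circ f z0 (rho k) - circ f z0 r) ->
     e <= Cmod (f (z0 + RtoC (rho k) * cis t)%C - f (z0 + RtoC r * cis t)%C)).
  { intros k. apply NNPP; intro B.
    assert (B2 : forall t, Cmod (f (z0 + RtoC (rho k) * cis t)%C - f (z0 + RtoC r * cis t)%C) < e).
    { intros t. apply Rnot_le_lt. intro L. apply B. now exists t. }
    apply B. exists 0. intros L. exfalso.
    assert (Pk : path_cont (fun t => f (z0 + RtoC (rho k) * cis t)%C) 0 (2 * PI)).
    { apply circ_path; [apply Hrho|]. intros z Hz. apply Hf. rewrite Hz. apply Hrho. }
    assert (Pr : path_cont (fun t => f (z0 + RtoC r * cis t)%C) 0 (2 * PI)).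
    { apply circ_path; [auto|]. intros z Hz. apply Hf. rewrite Hz. auto. }
    unfold circ in L. rewrite <- CInt_minus in L; try lra; auto.
    assert (Q := CInt_bound _ 0 (2 * PI) e ltac:(lra) (path_minus _ _ _ _ Pk Pr) (fun t _ => Rlt_le _ _ (B2 t))).
    assert ((2 * PI - 0) * e = eps / 2) by (unfold e; field; lra). lra. }
  destruct (extract_subseq (fun j p => (Rabs (rho p - r) < / (INR j + 1)) /\ eps <= Cmod (circ f z0 (rho p) - circ f z0 r)))
    as (s & Hs & Hs2).
  { intros j n. assert (P : 0 < / (INR j + 1)) by (apply Rinv_0_lt_compat; assert (A := pos_INR j); lra).
    destruct (Hlim _ P) as [n2 Hn2].
    apply NNPP; intro M. apply N. exists (n + n2)%nat. intros k Hk.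
    apply Rnot_le_lt. intro L. apply M. exists k. split; [lia|]. split; [apply Hn2; lia|exact L]. }
  set (th := fun k => proj1_sig (constructive_indefinite_description _ (Bad k))).
  assert (Hth : forall k, e <= Cmod (f (z0 + RtoC (rho (s k)) * cis (th (s k)))%C - f (z0 + RtoC r * cis (th (s k)))%C)).
  { intros k. apply (proj2_sig (constructive_indefinite_description _ (Bad (s k)))). apply Hs2. }
  destruct (bolzano_C (fun k => cis (th (s k))) 1) as (u & l & Hu & Hl).
  { intros k. rewrite Cmod_cis. lra. }
  assert (T0 : tends eventually (fun k => RtoC (rho (s (u k)))) (RtoC r)).
  { intros d d0. generalize (eventually_subseq (fun k => s (u k)) (strict_incr_comp s u Hs Hu) (fun k => Rabs (rho k - r) < d) (Hlim d d0)).
    unfold filtermap.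
    apply filter_imp. intros k Hk. rewrite <- RtoC_minus, Cmod_R. exact Hk. }
  assert (T1 : tends eventually (fun k => z0 + RtoC (rho (s (u k))) * cis (th (s (u k))))%C (z0 + RtoC r * l)%C).
  { apply (tends_plus eventually (fun _ => z0)); [apply tends_const; typeclasses eauto|].
    apply (tends_mult eventually (fun k => RtoC (rho (s (u k))))); auto. }
  assert (T2 : tends eventually (fun k => z0 + RtoC r * cis (th (s (u k))))%C (z0 + RtoC r * l)%C).
  { apply (tends_plus eventually (fun _ => z0)); [apply tends_const; typeclasses eauto|].
    apply (tends_mult eventually (fun k => RtoC r)); auto. apply tends_const; typeclasses eauto. }
  assert (Ll : Cmod l <= 1).
  { apply (tends_Cmod_le eventually _ _ 1 Hl). apply filter_forall. intros k. rewrite Cmod_cis. lra. }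
  assert (Cf : cont f (z0 + RtoC r * l)%C).
  { apply Hf. replace (z0 + RtoC r * l - z0)%C with (RtoC r * l)%C by ring.
    rewrite Cmod_mult, Cmod_R, Rabs_pos_eq by auto. assert (A := Cmod_ge_0 l). nra. }
  assert (T3 := tends_minus eventually _ _ _ _ (tends_cont f _ _ Cf T1) (tends_cont f _ _ Cf T2)).
  destruct (T3 e e0) as [n Hn]. specialize (Hn n (le_n _)). cbv beta in Hn.
  specialize (Hth (u n)).
  match type of Hn with Cmod (?a - ?b) < _ => replace (a - b)%C with a in Hn by ring end.
  lra.
Qed.

(** * Cauchy's formula, Taylor expansion, Liouville *)

Lemma circ_ext (f g : C -> C) (z0 : C) (r : R) : 0 <= r ->
  (forall z, on_circle z0 r z -> f z = g z) -> circ f z0 r = circ g z0 r.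
Proof.
  intros r0 E. assert (PP := PI_RGT_0). apply CInt_ext; [lra|].
  intros t _. apply E, on_circle_cis, r0.
Qed.

Lemma circ_plus (f g : C -> C) (z0 : C) (r : R) : 0 <= r ->
  (forall z, on_circle z0 r z -> cont f z) -> (forall z, on_circle z0 r z -> cont g z) ->
  circ (fun z => f z + g z)%C z0 r = (circ f z0 r + circ g z0 r)%C.
Proof.
  intros r0 Hf Hg. assert (PP := PI_RGT_0).
  apply (CInt_plus (fun t => f _) (fun t => g _)); [lra| |]; apply circ_path; auto.
Qed.

Lemma circ_scal (c : C) (f : C -> C) (z0 : C) (r : R) : 0 <= r ->
  (forall z, on_circle z0 r z -> cont f z) ->
  circ (fun z => c * f z)%C z0 r = (c * circ f z0 r)%C.
Proof.
  intros r0 Hf. assert (PP := PI_RGT_0).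
  apply (CInt_Cmult c (fun t => f _)); [lra|]. apply circ_path; auto.
Qed.

Lemma circ_const (c z0 : C) (r : R) : circ (fun _ => c) z0 r = (RtoC (2 * PI) * c)%C.
Proof. unfold circ. rewrite CInt_const. now rewrite Rminus_0_r. Qed.

Lemma circ_bound (f : C -> C) (z0 : C) (r M : R) : 0 <= r ->
  (forall z, on_circle z0 r z -> cont f z) -> (forall z, on_circle z0 r z -> Cmod (f z) <= M) ->
  Cmod (circ f z0 r) <= 2 * PI * M.
Proof.
  intros r0 Hf HM. assert (PP := PI_RGT_0). unfold circ.
  replace (2 * PI * M) with ((2 * PI - 0) * M) by ring.
  apply CInt_bound; [lra|apply circ_path; auto|]. intros t _. apply HM, on_circle_cis, r0.
Qed.

Lemma harmonic_lim (a b eps : R) : 0 < eps ->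
  eventually (fun k => Rabs (a + b * / (INR k + 1) - a) < eps).
Proof.
  intros He. assert (Hb := Rabs_pos b).
  generalize (inv_INR_small (eps / (Rabs b + 1)) ltac:(apply Rdiv_lt_0_compat; lra)).
  apply filter_imp. intros k Hk.
  assert (P : 0 < / (INR k + 1)) by (apply Rinv_0_lt_compat; assert (A := pos_INR k); lra).
  replace (a + b * / (INR k + 1) - a) with (b * / (INR k + 1)) by ring.
  rewrite Rabs_mult, (Rabs_pos_eq (/ _)) by lra.
  apply (Rmult_lt_compat_l (Rabs b + 1)) in Hk; [|lra].
  replace ((Rabs b + 1) * (eps / (Rabs b + 1))) with eps in Hk by (field; lra). nra.
Qed.

Lemma inv_INR_range (k : nat) : 0 < / (INR k + 1) <= 1.
Proof.
  assert (A := pos_INR k). split; [apply Rinv_0_lt_compat; lra|].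
  rewrite <- Rinv_1 at 2. apply Rinv_le_contravar; lra.
Qed.

(* If [rho] runs from [b] to [a] through radii whose circle integrals agree, continuity gives
   the same value at [a]. *)
Lemma circ_limit (f : C -> C) (z0 : C) (a b : R) : 0 <= a -> 0 <= b ->
  (forall z, Cmod (z - z0) <= Rmax a b -> cont f z) ->
  (forall k, circ f z0 (a + (b - a) * / (INR k + 1)) = circ f z0 b) ->
  circ f z0 a = circ f z0 b.
Proof.
  intros a0 b0 Hf E.
  apply (tends_unique eventually (fun k => circ f z0 (a + (b - a) * / (INR k + 1)))).
  - apply (circ_continuous f z0 a (fun k => a + (b - a) * / (INR k + 1)) (Rmax a b)); auto.
    + intros k. assert (Q := inv_INR_range k). assert (M1 := Rmax_l a b). assert (M2 := Rmax_r a b).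
      set (t := / (INR k + 1)) in *. split; nra.
    + apply Rmax_l.
    + intros eps He. apply harmonic_lim, He.
  - apply (tends_ext eventually (fun _ => circ f z0 b)).
    + apply filter_forall. intros k. now rewrite E.
    + apply tends_const. typeclasses eauto.
Qed.

(** The radius may be enlarged without changing the integral, and on a circle of large radius s the
    kernel differs from 1 by (zeta - z0) / (z - zeta), of modulus at most a / (s - a). *)
Lemma circ_kernel (z0 zeta : C) (r : R) : Cmod (zeta - z0) < r ->
  circ (fun z => (z - z0) / (z - zeta))%C z0 r = RtoC (2 * PI).
Proof.
  intros Hr. assert (PP := PI_RGT_0). assert (A0 := Cmod_ge_0 (zeta - z0)).
  set (a := Cmod (zeta - z0)) in *. set (k := fun z => ((z - z0) / (z - zeta))%C).
  assert (Far : forall z, a < Cmod (z - z0) -> Cmod (z - z0) - a <= Cmod (z - zeta)).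
  { intros z Hz. assert (T := Cmod_triangle3 z zeta z0). fold a in T. lra. }
  assert (NZ : forall z, a < Cmod (z - z0) -> (z - zeta)%C <> 0).
  { intros z Hz. apply Cmod_gt_0. specialize (Far z Hz). lra. }
  assert (Hk : forall z, a < Cmod (z - z0) -> cdiff k z).
  { intros z Hz. apply (cdiff_mult (fun z => z - z0)%C (fun z => / (z - zeta))%C).
    - apply cdiff_minus; [apply cdiff_id|apply cdiff_const].
    - apply (cdiff_inv (fun z => z - zeta)%C); auto.
      apply cdiff_minus; [apply cdiff_id|apply cdiff_const]. }
  apply Cminus_eq_0, Cmod_eq_0. apply Rle_antisym; [|apply Cmod_ge_0].
  apply Rnot_lt_le. intro N. set (D := Cmod (circ k z0 r - RtoC (2 * PI))) in N.
  (* With this radius D (s - a) = D r + 4 PI a, whereas the bound D <= 2 PI a / (s - a) would give D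
     (s - a) <= 2 PI a. *)
  set (s := r + 4 * PI * a / D + a).
  assert (Q : 0 <= 4 * PI * a / D) by (apply Rdiv_le_0_compat; nra).
  assert (E : circ k z0 r = circ k z0 s).
  { apply circ_annulus; [unfold s; lra|]. intros z Hz. apply Hk. lra. }
  assert (B : Cmod (circ (fun z => k z + RtoC (-1))%C z0 s) <= 2 * PI * (a / (s - a))).
  { apply circ_bound; [unfold s; lra| |]; intros z Hz; unfold on_circle in Hz.
    - apply cont_plus; [|apply cont_const]. apply cdiff_cont, Hk. rewrite Hz. unfold s; lra.
    - assert (L : a < Cmod (z - z0)) by (rewrite Hz; unfold s; lra).
      unfold k. replace ((z - z0) / (z - zeta) + RtoC (-1))%C with ((zeta - z0) / (z - zeta))%C
        by (field; auto).
      rewrite Cmod_div by auto. fold a. specialize (Far z L). rewrite Hz in Far.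
      apply Rmult_le_compat_l; [lra|]. apply Rinv_le_contravar; [unfold s; lra|auto]. }
  rewrite circ_plus, circ_const in B.
  - replace (circ k z0 s + RtoC (2 * PI) * RtoC (-1))%C with (circ k z0 r - RtoC (2 * PI))%C in B.
    2: { rewrite E. ring. }
    fold D in B.
    assert (s - a = r + 4 * PI * a / D) by (unfold s; ring).
    assert (D * (s - a) = D * r + 4 * PI * a) by (rewrite H; field; lra).
    assert (s0 : 0 < s - a) by lra.
    apply (Rmult_le_compat_r (s - a)) in B; [|lra].
    replace (2 * PI * (a / (s - a)) * (s - a)) with (2 * PI * a) in B by (field; lra).
    nra.
  - unfold s; lra.
  - intros z Hz. apply cdiff_cont, Hk. rewrite Hz. unfold s; lra.
  - intros z Hz. apply cont_const.
Qed.

Lemma cauchy_formula (f : C -> C) (z0 zeta : C) (r : R) :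
  Cmod (zeta - z0) < r -> (forall z, Cmod (z - z0) <= r -> cdiff f z) ->
  circ (fun z => f z * ((z - z0) / (z - zeta)))%C z0 r = (RtoC (2 * PI) * f zeta)%C.
Proof.
  intros Hr Hf. assert (A0 := Cmod_ge_0 (zeta - z0)).
  set (a := Cmod (zeta - z0)) in *.
  destruct (Hf zeta) as (phi & Hphi & E); [fold a; lra|].
  (* [g] is (f z - f zeta) / (z - zeta) * (z - z0), with Caratheodory's quotient filling the gap at
     [zeta]: there only its continuity is known, elsewhere on the disc it is differentiable. *)
  set (g := fun z => (phi z * (z - z0))%C).
  assert (D0 : forall z, Cmod (z - z0) <= r -> z <> zeta -> cdiff g z).
  { intros z Hz n. assert (NZ : (z - zeta)%C <> 0) by (intro Q; apply n, Cminus_eq_0, Q).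
    assert (Dh : cdiff (fun z => (f z - f zeta) * / (z - zeta) * (z - z0))%C z).
    { apply (cdiff_mult (fun z => (f z - f zeta) * / (z - zeta))%C (fun z => z - z0)%C).
      - apply (cdiff_mult (fun z => f z - f zeta)%C (fun z => / (z - zeta))%C).
        + apply cdiff_minus; [auto|apply cdiff_const].
        + apply (cdiff_inv (fun z => z - zeta)%C); auto.
          apply cdiff_minus; [apply cdiff_id|apply cdiff_const].
      - apply cdiff_minus; [apply cdiff_id|apply cdiff_const]. }
    apply (cdiff_local _ g) in Dh; auto.
    exists (Cmod (z - zeta)). split; [apply Cmod_gt_0; auto|].
    intros w Hw. unfold g. rewrite E. field. intro Q. apply Cminus_eq_0 in Q. subst w.
    rewrite Cmod_minus_sym in Hw. lra. }
  assert (C0 : forall z, Cmod (z - z0) <= r -> cont g z).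
  { intros z Hz. destruct (classic (z = zeta)) as [->|n].
    - apply cont_mult; [auto|]. apply cont_minus; [apply cont_id|apply cont_const].
    - apply cdiff_cont, D0; auto. }
  assert (NE : forall z, Cmod (z - z0) <> a -> z <> zeta).
  { intros z Hz ->. apply Hz. reflexivity. }
  assert (J1 : circ g z0 a = circ g z0 r).
  { apply circ_limit; try lra.
    - intros z Hz. apply C0. rewrite Rmax_right in Hz; lra.
    - intros k. assert (Q := inv_INR_range k). set (t := / (INR k + 1)) in *.
      apply circ_annulus; [nra|]. intros z Hz. apply D0; [lra|]. apply NE. nra. }
  assert (J2 : circ g z0 0 = circ g z0 a).
  { destruct (Req_dec a 0) as [->|n]; [reflexivity|].
    (* Every annulus must avoid the circle through [zeta], so a smaller radius [b] is compared with
       [a] through radii that increase to [a]; afterwards the radius decreases to 0. *)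
    assert (In : forall b, 0 < b <= a -> circ g z0 b = circ g z0 a).
    { intros b Hb. symmetry. apply circ_limit; try lra.
      - intros z Hz. apply C0. rewrite Rmax_left in Hz; lra.
      - intros k. assert (Q := inv_INR_range k). set (t := / (INR k + 1)) in *.
        destruct (Req_dec b a) as [e|n2]; [rewrite e; f_equal; ring|].
        symmetry. apply circ_annulus; [nra|]. intros z Hz.
        assert (a + (b - a) * t < a) by nra.
        apply D0; [lra|]. apply NE. lra. }
    apply circ_limit; try lra.
    - intros z Hz. apply C0. rewrite Rmax_right in Hz; lra.
    - intros k. assert (Q := inv_INR_range k). apply In. nra. }
  assert (J3 : circ g z0 0 = 0).
  { rewrite (circ_ext _ (fun _ => RtoC 0)).
    - rewrite circ_const. ring.
    - lra.
    - intros z Hz. unfold g. apply Cmod_eq_0 in Hz. rewrite Hz. ring. }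
  set (k := fun z => ((z - z0) / (z - zeta))%C).
  assert (NZ : forall z, on_circle z0 r z -> (z - zeta)%C <> 0).
  { intros z Hz Q. apply Cminus_eq_0 in Q. subst z. unfold on_circle in Hz. fold a in Hz. lra. }
  rewrite (circ_ext _ (fun z => g z + f zeta * k z)%C).
  - rewrite circ_plus, circ_scal.
    + rewrite <- J1, <- J2, J3. unfold k. rewrite circ_kernel by auto. ring.
    + lra.
    + intros z Hz. apply cont_mult; [apply cont_minus; [apply cont_id|apply cont_const]|].
      apply (cont_inv (fun z => z - zeta)%C); [auto|]. apply cont_minus; [apply cont_id|apply cont_const].
    + lra.
    + intros z Hz. apply C0. rewrite Hz. lra.
    + intros z Hz. apply cont_mult; [apply cont_const|].
      apply cont_mult; [apply cont_minus; [apply cont_id|apply cont_const]|].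
      apply (cont_inv (fun z => z - zeta)%C); [auto|]. apply cont_minus; [apply cont_id|apply cont_const].
  - lra.
  - intros z Hz. unfold g, k. replace (f z) with ((f z - f zeta) + f zeta)%C by ring. rewrite E.
    field. auto.
Qed.

Fixpoint psum (c : nat -> C) (eta : C) (N : nat) : C :=
  match N with O => RtoC 0 | S n => (psum c eta n + c n * eta ^ n)%C end.

(** Cauchy's estimates for the coefficients, together with a remainder bound for every truncation,
    stand for a convergent power series. Both are closed inequalities in which [r] and [M] can serve
    a whole family, so they survive pointwise limits. *)
Definition taylor_at (f : C -> C) (p : C) (r M : R) (c : nat -> C) : Prop :=
  (forall n, Cmod (c n) <= M / r ^ n) /\
  forall N eta, Cmod eta < r ->
    Cmod (f (p + eta)%C - psum c eta N) <= M * (Cmod eta / r) ^ N * (r / (r - Cmod eta)).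

(** The kernel k = (z - p) / (z - p - eta) satisfies k = 1 + eta / (z - p) * k. Applying this [N]
    times in Cauchy's formula yields the first [N] coefficients and the exact remainder eta^N J_N /
    (2 PI), which is bounded through |k| <= r / (r - |eta|) on the circle. *)
Lemma cauchy_taylor (f : C -> C) (p : C) (r M : R) :
  0 < r -> (forall z, Cmod (z - p) <= r -> cdiff f z) ->
  (forall z, on_circle p r z -> Cmod (f z) <= M) -> exists c, taylor_at f p r M c.
Proof.
  intros r0 Hf HM. assert (PP := PI_RGT_0).
  assert (P2 : RtoC (2 * PI) <> 0) by (intro Q; apply RtoC_inj in Q; lra).
  assert (M0 : 0 <= M).
  { eapply Rle_trans; [apply Cmod_ge_0|apply (HM _ (on_circle_cis p r 0 ltac:(lra)))]. }
  assert (NZ : forall z, on_circle p r z -> (z - p)%C <> 0).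
  { intros z Hz. apply Cmod_gt_0. rewrite Hz. exact r0. }
  assert (Cp : forall n z, on_circle p r z -> cont (fun z => / (z - p) ^ n)%C z).
  { intros n z Hz. apply (cont_inv (fun z => (z - p) ^ n)%C); [apply Cpow_nz; auto|].
    induction n; [apply (cont_const 1)|].
    apply (cont_mult (fun z => z - p)%C (fun z => (z - p) ^ n)%C); auto.
    apply cont_minus; [apply cont_id|apply cont_const]. }
  assert (Cf : forall n z, on_circle p r z -> cont (fun z => f z * / (z - p) ^ n)%C z).
  { intros n z Hz. apply cont_mult; [|apply Cp; auto]. apply cdiff_cont, Hf. rewrite Hz. lra. }
  assert (Mn : forall n z, on_circle p r z -> Cmod (f z * / (z - p) ^ n)%C <= M / r ^ n).
  { intros n z Hz. rewrite Cmod_mult, Cmod_inv, Cmod_pow by (apply Cpow_nz; auto).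
    rewrite Hz. apply Rmult_le_compat_r; [|apply HM; auto].
    left; apply Rinv_0_lt_compat, pow_lt; auto. }
  set (I := fun n => circ (fun z => f z * / (z - p) ^ n)%C p r).
  exists (fun n => (/ RtoC (2 * PI) * I n)%C). split.
  - intros n. rewrite Cmod_mult, Cmod_inv, Cmod_R, Rabs_pos_eq by (auto; lra).
    apply (Rmult_le_reg_l (2 * PI)); [lra|]. rewrite <- Rmult_assoc, Rinv_r, Rmult_1_l by lra.
    apply (circ_bound (fun z => f z * / (z - p) ^ n)%C p r (M / r ^ n)); [lra| |]; intros; [apply Cf|apply Mn]; auto.
  - intros N eta He.
    assert (NZ2 : forall z, on_circle p r z -> (z - (p + eta))%C <> 0).
    { intros z Hz Q. apply Cminus_eq_0 in Q. unfold on_circle in Hz. subst z.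
      replace (p + eta - p)%C with eta in Hz by ring. lra. }
    set (k := fun z => ((z - p) / (z - (p + eta)))%C).
    assert (Ck : forall z, on_circle p r z -> cont k z).
    { intros z Hz. apply cont_mult; [apply cont_minus; [apply cont_id|apply cont_const]|].
      apply (cont_inv (fun z => z - (p + eta))%C); [auto|]. apply cont_minus; [apply cont_id|apply cont_const]. }
    set (J := fun n => circ (fun z => f z * / (z - p) ^ n * k z)%C p r).
    assert (E : forall N, (f (p + eta) - psum (fun n => / RtoC (2 * PI) * I n) eta N
                = / RtoC (2 * PI) * (eta ^ N * J N))%C).
    { induction N0.
      - simpl. replace (J O) with (RtoC (2 * PI) * f (p + eta))%C; [field; auto|].
        rewrite <- (cauchy_formula f p (p + eta)%C r); auto.
        + unfold J. apply (circ_ext _ _ p r); [lra|]. intros z Hz. unfold k. simpl. field. auto.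
        + replace (p + eta - p)%C with eta by ring. exact He.
      - simpl psum. assert (S1 : J N0 = (I N0 + eta * J (S N0))%C).
        { unfold J at 1. rewrite (circ_ext _ (fun z => f z * / (z - p) ^ N0 + eta * (f z * / (z - p) ^ (S N0) * k z))%C).
          - rewrite circ_plus, circ_scal; try lra; try reflexivity; auto.
            + intros z Hz. apply (cont_mult (fun z => f z * / (z - p) ^ S N0)%C); auto.
            + intros z Hz. apply (cont_mult (fun _ => eta)); [apply cont_const|].
              apply (cont_mult (fun z => f z * / (z - p) ^ S N0)%C); auto.
          - lra.
          - intros z Hz. unfold k. rewrite Cpow_S. assert (Q := Cpow_nz _ N0 (NZ z Hz)).
            field. repeat split; auto. }
        transitivity ((f (p + eta) - psum (fun n => / RtoC (2 * PI) * I n) eta N0) - / RtoC (2 * PI) * I N0 * eta ^ N0)%C; [ring|].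
        rewrite IHN0, S1, Cpow_S. ring. }
    rewrite E, !Cmod_mult, Cmod_inv, Cmod_R, Rabs_pos_eq, Cmod_pow by (auto; lra).
    assert (B : Cmod (J N) <= 2 * PI * (M / r ^ N * (r / (r - Cmod eta)))).
    { apply (circ_bound (fun z => f z * / (z - p) ^ N * k z)%C p r (M / r ^ N * (r / (r - Cmod eta)))); [lra| |].
      - intros z Hz. apply (cont_mult (fun z => f z * / (z - p) ^ N)%C); auto.
      - intros z Hz. rewrite Cmod_mult. apply Rmult_le_compat; try apply Cmod_ge_0; auto.
        unfold k. rewrite Cmod_div by auto. rewrite Hz. apply Rmult_le_compat_l; [lra|].
        apply Rinv_le_contravar; [lra|].
        assert (T := Cmod_triangle3 z (p + eta) p). replace (p + eta - p)%C with eta in T by ring.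
        rewrite Hz in T. lra. }
    apply (Rmult_le_compat_l (/ (2 * PI) * Cmod eta ^ N)) in B.
    + rewrite <- Rmult_assoc. eapply Rle_trans; [exact B|]. right.
      unfold Rdiv. rewrite Rpow_mult_distr, pow_inv. field. repeat split; try lra.
      apply pow_nonzero. lra.
    + apply Rmult_le_pos; [left; apply Rinv_0_lt_compat; lra|]. apply pow_le, Cmod_ge_0.
Qed.

Lemma liouville (f : C -> C) (M : R) :
  (forall z, cdiff f z) -> (forall z, Cmod (f z) <= M) -> forall z, f z = f 0.
Proof.
  intros Hf HM z. apply Cminus_eq_0, Cmod_eq_0, Rle_antisym; [|apply Cmod_ge_0].
  apply Rnot_lt_le. intro N. set (D := Cmod (f z - f 0)) in N.
  assert (M0 : 0 <= M) by (eapply Rle_trans; [apply Cmod_ge_0|apply (HM 0)]).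
  assert (Z0 := Cmod_ge_0 z). set (x := Cmod z) in *.
  (* Truncation after the constant term bounds |f z - f 0| by M x / (r - x). For this radius D (r -
     x) = M x + D, so that bound lies below [D]. *)
  set (r := x + M * x / D + 1).
  assert (Q : 0 <= M * x / D) by (apply Rdiv_le_0_compat; [nra|lra]).
  destruct (cauchy_taylor f 0 r M) as (c & _ & H); [unfold r; lra|auto|auto|].
  assert (H0 := H 1%nat 0 ltac:(rewrite Cmod_0; unfold r; lra)).
  assert (H1 := H 1%nat z ltac:(fold x; unfold r; lra)).
  simpl in H0, H1. rewrite Cmod_0 in H0. fold x in H1.
  replace (0 + z)%C with z in H1 by ring. replace (0 + 0)%C with (RtoC 0) in H0 by ring.
  replace (0 + c O * 1)%C with (c O) in * by ring.
  replace (M * (0 / r * 1) * (r / (r - 0))) with 0 in H0 by (field; unfold r; lra).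
  assert (E : f 0 = c O).
  { apply Cminus_eq_0, Cmod_eq_0, Rle_antisym; [exact H0|apply Cmod_ge_0]. }
  rewrite <- E in H1. fold D in H1.
  replace (M * (x / r * 1) * (r / (r - x))) with (M * x / (r - x)) in H1 by (field; unfold r; lra).
  assert (P : 0 < r - x) by (unfold r; lra).
  apply (Rmult_le_compat_r (r - x)) in H1; [|lra].
  replace (M * x / (r - x) * (r - x)) with (M * x) in H1 by (field; lra).
  assert (D * (r - x) = M * x + D) by (unfold r; field; lra). lra.
Qed.

(** * Montel and Hurwitz *)

Lemma diagonal_subseq (a : nat -> nat -> C) (B : nat -> R) :
  (forall n k, Cmod (a n k) <= B n) ->
  exists s, strict_incr s /\ forall n, exists l, tends eventually (fun k => a n (s k)) l.
Proof.
  intros HB.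
  assert (Ex : forall n (S : nat -> nat), exists t,
            strict_incr t /\ exists l, tends eventually (fun k => a n (S (t k))) l).
  { intros n S. destruct (bolzano_C (fun k => a n (S k)) (B n)) as (t & l & Ht & Hl); [auto|].
    exists t. split; [auto|]. now exists l. }
  set (T := fun n S => proj1_sig (constructive_indefinite_description _ (Ex n S))).
  assert (HT : forall n S, strict_incr (T n S) /\ exists l, tends eventually (fun k => a n (S (T n S k))) l).
  { intros n S. apply (proj2_sig (constructive_indefinite_description _ (Ex n S))). }
  set (Q := fix Q n := match n with
            | O => T O (fun k => k)
            | S m => fun k => Q m (T (S m) (Q m) k) end).
  assert (Q1 : forall n, strict_incr (Q n)).
  { induction n; simpl; [apply HT|]. apply strict_incr_comp; [auto|apply HT]. }
  assert (Q2 : forall n, exists l, tends eventually (fun k => a n (Q n k)) l).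
  { destruct n; [apply (proj2 (HT O (fun k => k)))|apply (proj2 (HT (S n) (Q n)))]. }
  assert (Q3 : forall n m, (n <= m)%nat -> exists t, strict_incr t /\ forall k, Q m k = Q n (t k)).
  { induction 1.
    - exists (fun k => k). split; [intros k; lia|auto].
    - destruct IHle as (t & Ht & E). exists (fun k => t (T (S m) (Q m) k)). split.
      + apply strict_incr_comp; [auto|apply HT].
      + intros k. simpl. apply E. }
  exists (fun k => Q k k). split.
  - intros k. simpl. apply strict_incr_lt; [apply Q1|].
    assert (G := strict_incr_ge _ (proj1 (HT (S k) (Q k))) (S k)). lia.
  - intros n. destruct (Q2 n) as [l Hl]. exists l. intros eps He.
    destruct (Hl eps He) as [N HN]. exists (n + N)%nat. intros k Hk.
    destruct (Q3 n k ltac:(lia)) as (t & Ht & E). rewrite E. apply HN.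
    assert (G := strict_incr_ge t Ht k). lia.
Qed.

Lemma psum_tends (c : nat -> nat -> C) (l : nat -> C) (eta : C) (N : nat) :
  (forall n, tends eventually (fun k => c k n) (l n)) ->
  tends eventually (fun k => psum (c k) eta N) (psum l eta N).
Proof.
  intros H. induction N; simpl; [apply tends_const; typeclasses eauto|].
  apply (tends_plus eventually (fun k => psum (c k) eta N)); auto.
  apply (tends_mult eventually (fun k => c k N)); auto. apply tends_const; typeclasses eauto.
Qed.

Lemma psum_uniform (c : nat -> nat -> C) (l : nat -> C) (rho : R) (N : nat) :
  0 <= rho -> (forall n, tends eventually (fun k => c k n) (l n)) ->
  forall eps, 0 < eps -> eventually (fun k => forall eta, Cmod eta <= rho ->
    Cmod (psum (c k) eta N - psum l eta N) < eps).
Proof.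
  intros r0 H. induction N; intros eps He.
  - exists O. intros k _ eta _. simpl. replace (0 - 0)%C with (RtoC 0) by ring. now rewrite Cmod_0.
  - assert (P : 0 < rho ^ N + 1) by (assert (0 <= rho ^ N) by (apply pow_le; auto); lra).
    generalize (eventually_and _ _ (IHN (eps / 2) ltac:(lra))
      (H N (eps / (2 * (rho ^ N + 1))) ltac:(apply Rdiv_lt_0_compat; lra))).
    apply filter_imp. intros k [H1 H2] eta Heta. simpl.
    replace (psum (c k) eta N + c k N * eta ^ N - (psum l eta N + l N * eta ^ N))%C
      with ((psum (c k) eta N - psum l eta N) + (c k N - l N) * eta ^ N)%C by ring.
    eapply Rle_lt_trans; [apply Cmod_triangle|]. specialize (H1 eta Heta).
    rewrite Cmod_mult, Cmod_pow.
    assert (L : Cmod eta ^ N <= rho ^ N) by (apply pow_incr; split; [apply Cmod_ge_0|auto]).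
    assert (L0 : 0 <= Cmod eta ^ N) by (apply pow_le, Cmod_ge_0).
    assert (X : Cmod (c k N - l N) * Cmod eta ^ N <= eps / (2 * (rho ^ N + 1)) * (rho ^ N + 1)).
    { apply Rmult_le_compat; [apply Cmod_ge_0|auto|lra|lra]. }
    replace (eps / (2 * (rho ^ N + 1)) * (rho ^ N + 1)) with (eps / 2) in X by (field; lra). lra.
Qed.

Lemma pow_ratio_small (x r A eps : R) : 0 <= x < r -> 0 < eps -> exists N, A * (x / r) ^ N < eps.
Proof.
  intros Hx He.
  assert (q0 : 0 <= x / r) by (apply Rdiv_le_0_compat; lra).
  assert (q1 : x / r < 1) by (apply Rlt_div_l; lra).
  assert (A0 := Rabs_pos A).
  destruct (pow_lt_1_zero (x / r) ltac:(rewrite Rabs_pos_eq; lra) (eps / (Rabs A + 1))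
     ltac:(apply Rdiv_lt_0_compat; lra)) as [N HN].
  exists N. specialize (HN N (le_n _)). assert (P := pow_le _ N q0). rewrite Rabs_pos_eq in HN by auto.
  assert (B := Rle_abs A).
  apply Rle_lt_trans with ((Rabs A + 1) * (x / r) ^ N); [nra|].
  replace eps with ((Rabs A + 1) * (eps / (Rabs A + 1))) by (field; lra).
  apply Rmult_lt_compat_l; lra.
Qed.

Lemma ratio_pow_mono (M x rho r : R) (N : nat) : 0 <= M -> 0 <= x <= rho -> rho < r ->
  M * (x / r) ^ N * (r / (r - x)) <= M * (rho / r) ^ N * (r / (r - rho)).
Proof.
  intros M0 Hx Hr.
  assert (0 <= x / r) by (apply Rdiv_le_0_compat; lra).
  assert (x / r <= rho / r) by (apply Rmult_le_compat_r; [left; apply Rinv_0_lt_compat|]; lra).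
  apply Rmult_le_compat.
  - apply Rmult_le_pos; [auto|apply pow_le; auto].
  - apply Rdiv_le_0_compat; lra.
  - apply Rmult_le_compat_l; [auto|]. apply pow_incr. lra.
  - apply Rmult_le_compat_l; [lra|]. apply Rinv_le_contravar; lra.
Qed.

Lemma taylor_bound_nonneg (f : C -> C) (p : C) (r M : R) (c : nat -> C) : taylor_at f p r M c -> 0 <= M.
Proof.
  intros [H _]. specialize (H O). simpl in H. assert (A := Cmod_ge_0 (c O)). lra.
Qed.

(** Montel's theorem for a bounded family: the coefficients of each order lie in a fixed disc, so a
    diagonal subsequence makes all of them converge. On a smaller disc one truncation order makes
    all remainders small, and the truncations converge uniformly. *)
Lemma taylor_compactness (f : nat -> C -> C) (p : C) (r M : R) :
  0 < r -> (forall k, exists c, taylor_at (f k) p r M c) ->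
  exists s w, strict_incr s /\ (exists c, taylor_at w p r M c) /\
    forall rho, 0 <= rho < r -> forall eps, 0 < eps ->
      eventually (fun k => forall z, Cmod (z - p) <= rho -> Cmod (f (s k) z - w z) < eps).
Proof.
  intros r0 Hc.
  set (c := fun k => proj1_sig (constructive_indefinite_description _ (Hc k))).
  assert (T : forall k, taylor_at (f k) p r M (c k)).
  { intros k. apply (proj2_sig (constructive_indefinite_description _ (Hc k))). }
  clearbody c.
  assert (M0 := taylor_bound_nonneg _ _ _ _ _ (T O)).
  destruct (diagonal_subseq (fun n k => c k n) (fun n => M / r ^ n)) as (s & Hs & Hl0).
  { intros n k. apply (proj1 (T k)). }
  set (l := fun n => proj1_sig (constructive_indefinite_description _ (Hl0 n))).
  assert (Hl : forall n, tends eventually (fun k => c (s k) n) (l n)).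
  { intros n. apply (proj2_sig (constructive_indefinite_description _ (Hl0 n))). }
  clearbody l.
  (* The further subsequence may depend on [z]: the remainder bounds against the limit coefficients
     [l] determine the value [W], because they tend to 0 with [N]. Outside the disc [W] is
     arbitrary. *)
  assert (Hw : forall z, exists W, Cmod (z - p) < r -> forall N,
    Cmod (W - psum l (z - p) N) <= M * (Cmod (z - p) / r) ^ N * (r / (r - Cmod (z - p)))).
  { intros z. destruct (Rlt_dec (Cmod (z - p)) r) as [L|L]; [|exists 0; intros; lra].
    destruct (bolzano_C (fun k => f (s k) z) (M * (r / (r - Cmod (z - p))))) as (t & W & Ht & HW).
    { intros k. assert (B := proj2 (T (s k)) O _ L). simpl in B. rewrite Rmult_1_r in B.
      replace (p + (z - p))%C with z in B by ring. replace (f (s k) z - 0)%C with (f (s k) z) in B by ring.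
      exact B. }
    exists W. intros _ N.
    apply (tends_Cmod_le eventually (fun k => f (s (t k)) z - psum (c (s (t k))) (z - p) N)%C).
    - apply (tends_minus eventually (fun k => f (s (t k)) z)); auto.
      apply psum_tends. intros n. apply (tends_subseq (fun k => c (s k) n)); auto.
    - apply filter_forall. intros k. assert (B := proj2 (T (s (t k))) N _ L).
      replace (p + (z - p))%C with z in B by ring. exact B. }
  set (w := fun z => proj1_sig (constructive_indefinite_description _ (Hw z))).
  assert (Tw : forall z, Cmod (z - p) < r -> forall N,
    Cmod (w z - psum l (z - p) N) <= M * (Cmod (z - p) / r) ^ N * (r / (r - Cmod (z - p)))).
  { intros z. apply (proj2_sig (constructive_indefinite_description _ (Hw z))). }
  clearbody w. exists s, w. split; [auto|]. split.
  - exists l. split.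
    + intros n. apply (tends_Cmod_le eventually (fun k => c (s k) n)); auto.
      apply filter_forall. intros k. apply (proj1 (T (s k))).
    + intros N eta He. assert (B := Tw (p + eta)%C). replace (p + eta - p)%C with eta in B by ring.
      apply B, He.
  - intros rho Hrho eps He.
    (* Two remainders, of [f (s k)] and of [w], cost eps / 4 each, and the difference of the partial
       sums costs eps / 2. *)
    destruct (pow_ratio_small rho r (M * (r / (r - rho))) (eps / 4) ltac:(lra) ltac:(lra)) as [N HN].
    generalize (psum_uniform (fun k => c (s k)) l rho N ltac:(lra) Hl (eps / 2) ltac:(lra)).
    apply filter_imp. intros k Hk z Hz.
    assert (L : Cmod (z - p) < r) by lra.
    assert (B1 := Tw z L N). assert (B2 := proj2 (T (s k)) N _ L).
    replace (p + (z - p))%C with z in B2 by ring. specialize (Hk _ Hz).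
    assert (B3 := ratio_pow_mono M (Cmod (z - p)) rho r N M0 (conj (Cmod_ge_0 _) Hz) (proj2 Hrho)).
    assert (T1 := Cmod_triangle3 (f (s k) z) (psum (c (s k)) (z - p) N) (w z)).
    assert (T2 := Cmod_triangle3 (psum (c (s k)) (z - p) N) (psum l (z - p) N) (w z)).
    rewrite (Cmod_minus_sym (psum l (z - p) N) (w z)) in T2.
    replace (M * (rho / r) ^ N * (r / (r - rho))) with (M * (r / (r - rho)) * (rho / r) ^ N) in B3 by ring.
    lra.
Qed.

(** * Local consequences of a Taylor expansion, and Hurwitz *)

Lemma taylor_value (f : C -> C) (p : C) (r M : R) (c : nat -> C) :
  0 < r -> taylor_at f p r M c -> f p = c O.
Proof.
  intros r0 [_ H]. specialize (H 1%nat 0 ltac:(rewrite Cmod_0; exact r0)). simpl in H.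
  rewrite Cmod_0 in H. replace (p + 0)%C with p in H by ring.
  replace (M * (0 / r * 1) * (r / (r - 0))) with 0 in H by (field; lra).
  apply Cminus_eq_0, Cmod_eq_0, Rle_antisym; [|apply Cmod_ge_0].
  replace (f p - c O)%C with (f p - (0 + c O * 1))%C by ring. exact H.
Qed.

Lemma taylor_tail_half (M x r : R) (N : nat) : 0 <= M -> 0 < r -> 0 <= x <= r / 2 ->
  M * (x / r) ^ N * (r / (r - x)) <= 2 * M * (x / r) ^ N.
Proof.
  intros M0 r0 Hx. assert (r / (r - x) <= 2).
  { apply Rle_div_l; lra. }
  assert (0 <= M * (x / r) ^ N).
  { apply Rmult_le_pos; [auto|]. apply pow_le, Rdiv_le_0_compat; lra. }
  nra.
Qed.

Lemma taylor_cdiff (f : C -> C) (p : C) (r M : R) (c : nat -> C) :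
  0 < r -> taylor_at f p r M c -> cdiff f p.
Proof.
  intros r0 T. assert (E := taylor_value f p r M c r0 T).
  assert (M0 := taylor_bound_nonneg _ _ _ _ _ T).
  apply (cdiff_intro f p (c 1%nat)). intros eps He.
  set (d := Rmin (r / 2) (eps * (r * r) / (2 * M + 1))).
  assert (rr : 0 < r * r) by nra.
  assert (d0 : 0 < d).
  { apply Rmin_pos; [lra|]. apply Rdiv_lt_0_compat; [nra|lra]. }
  exists d. split; [exact d0|]. intros w Hw.
  assert (D1 : d <= r / 2) by apply Rmin_l.
  assert (D2 : d * (2 * M + 1) <= eps * (r * r)).
  { apply Rle_div_r; [lra|apply Rmin_r]. }
  set (x := Cmod (w - p)) in *. assert (x0 : 0 <= x) by apply Cmod_ge_0.
  assert (B := proj2 T 2%nat (w - p)%C ltac:(fold x; lra)). fold x in B.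
  assert (B2 := taylor_tail_half M x r 2 M0 r0 ltac:(lra)).
  simpl psum in B. replace (p + (w - p))%C with w in B by ring. rewrite E.
  replace (f w - c 0%nat - c 1%nat * (w - p))%C
    with (f w - (0 + c 0%nat * 1 + c 1%nat * ((w - p) * 1)))%C by ring.
  eapply Rle_trans; [exact B|]. eapply Rle_trans; [exact B2|].
  replace (2 * M * (x / r) ^ 2) with ((2 * M * x / (r * r)) * x) by (field; lra).
  apply Rmult_le_compat_r; [auto|]. apply Rle_div_l; [auto|]. nra.
Qed.

(** If all coefficients vanish, the remainder bounds force [f] to vanish on the disc. Otherwise the
    first nonzero term dominates on a small circle. *)
Lemma taylor_isolated_zero (f : C -> C) (p : C) (r M : R) (c : nat -> C) :
  0 < r -> taylor_at f p r M c ->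
  (forall z, Cmod (z - p) < r -> f z = 0) \/
  exists t d, 0 < t < r /\ 0 < d /\ forall z, on_circle p t z -> d <= Cmod (f z).
Proof.
  intros r0 T. assert (M0 := taylor_bound_nonneg _ _ _ _ _ T).
  assert (PZ : forall N eta, (forall n, (n < N)%nat -> c n = 0) -> psum c eta N = 0).
  { induction N; intros eta H; simpl; [reflexivity|]. rewrite IHN, H by (auto; lia). ring. }
  destruct (classic (forall n, c n = 0)) as [A|A].
  - left. intros z Hz. apply Cmod_eq_0, Rle_antisym; [|apply Cmod_ge_0].
    apply Rnot_lt_le. intro N0. assert (x0 := Cmod_ge_0 (z - p)).
    destruct (pow_ratio_small (Cmod (z - p)) r (M * (r / (r - Cmod (z - p)))) _ ltac:(lra) N0) as [N HN].
    assert (B := proj2 T N _ Hz). rewrite PZ in B by auto.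
    replace (p + (z - p))%C with z in B by ring. replace (f z - 0)%C with (f z) in B by ring. lra.
  - right. assert (Hm : exists m, c m <> 0 /\ forall n, (n < m)%nat -> c n = 0).
    { apply NNPP; intro N. apply A. intros n. induction n as [n IH] using Wf_nat.lt_wf_ind.
      apply NNPP; intro C1. apply N. now exists n. }
    destruct Hm as (m & Cm & Hm). apply Cmod_gt_0 in Cm.
    assert (rm : 0 < r ^ S m) by (apply pow_lt; auto).
    (* The first bound makes the remainder at most 2 M (t / r)^(m+1); the second makes this at most
       half of |c_m| t^m, leaving the other half as the lower bound [d]. *)
    set (t := Rmin (r / 2) (Cmod (c m) * r ^ S m / (4 * M + 1))).
    assert (t0 : 0 < t).
    { apply Rmin_pos; [lra|]. apply Rdiv_lt_0_compat; [nra|lra]. }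
    assert (D1 : t <= r / 2) by apply Rmin_l.
    assert (D2 : t * (4 * M + 1) <= Cmod (c m) * r ^ S m).
    { apply Rle_div_r; [lra|apply Rmin_r]. }
    assert (tm : 0 < t ^ m) by (apply pow_lt; auto).
    exists t, (Cmod (c m) * t ^ m / 2). split; [lra|]. split; [nra|].
    intros z Hz. unfold on_circle in Hz.
    assert (B := proj2 T (S m) (z - p)%C ltac:(lra)). rewrite Hz in B.
    assert (B2 := taylor_tail_half M t r (S m) M0 r0 ltac:(lra)).
    simpl psum in B. rewrite PZ in B by auto. replace (p + (z - p))%C with z in B by ring.
    assert (B3 : 2 * M * (t / r) ^ S m <= Cmod (c m) * t ^ m / 2).
    { unfold Rdiv at 1. rewrite Rpow_mult_distr, pow_inv.
      replace (2 * M * (t ^ S m * / r ^ S m)) with ((2 * M * t * t ^ m) / r ^ S m) by (simpl; field; split; [apply pow_nonzero; lra|lra]).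
      apply Rle_div_l; [auto|]. nra. }
    assert (T1 := Cmod_triangle_minus (c m * (z - p) ^ m) (f z)).
    rewrite Cmod_minus_sym, Cmod_mult, Cmod_pow, Hz in T1.
    replace (f z - (0 + c m * (z - p) ^ m))%C with (f z - c m * (z - p) ^ m)%C in B by ring.
    lra.
Qed.

(** This serves to expand a limit about a new centre: the expansion obtained by compactness there
    belongs to the same function, by uniqueness of limits. *)
Lemma taylor_limit (f : nat -> C -> C) (w : C -> C) (p : C) (r M : R) :
  0 < r -> (forall k, exists c, taylor_at (f k) p r M c) ->
  (forall z, Cmod (z - p) < r -> tends eventually (fun k => f k z) (w z)) ->
  exists c, taylor_at w p r M c.
Proof.
  intros r0 Hf Hw. destruct (taylor_compactness f p r M r0 Hf) as (s & w' & Hs & (c & T1 & T2) & U).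
  assert (E : forall z, Cmod (z - p) < r -> w' z = w z).
  { intros z Hz. apply (tends_unique eventually (fun k => f (s k) z)).
    - intros eps He. generalize (U _ (conj (Cmod_ge_0 _) Hz) eps He). apply filter_imp.
      intros k Hk. apply Hk. lra.
    - apply (tends_subseq (fun k => f k z)); auto. }
  exists c. split; [auto|]. intros N eta He. rewrite <- E; [auto|].
  replace (p + eta - p)%C with eta by ring. exact He.
Qed.

(* Hurwitz: a zero of the limit of the reciprocals spreads over the whole disc, since otherwise
   the maximum principle on a small circle would bound [v k] at that zero. *)
Lemma bounded_below_normal (v : nat -> C -> C) (z0 : C) (R0 r0 : R) :
  0 < R0 -> 0 < r0 -> (forall k z, Cmod (z - z0) < R0 -> cdiff (v k) z) ->
  (forall k z, Cmod (z - z0) < R0 -> r0 <= Cmod (v k z)) ->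
  exists s, strict_incr s /\
   ((exists w : C -> C, (forall z, Cmod (z - z0) < R0 / 4 -> w z <> 0 /\ cdiff w z) /\
      forall eps, 0 < eps -> eventually (fun k => forall z, Cmod (z - z0) < R0 / 4 ->
         Cmod (/ v (s k) z - w z) < eps)) \/
    forall L, eventually (fun k => forall z, Cmod (z - z0) < R0 / 4 -> L < Cmod (v (s k) z))).
Proof.
  intros HR Hr Hv Hlow.
  assert (NZ : forall k z, Cmod (z - z0) < R0 -> v k z <> 0).
  { intros k z Hz. apply Cmod_gt_0. specialize (Hlow k z Hz). lra. }
  assert (Dw : forall k z, Cmod (z - z0) < R0 -> cdiff (fun z => / v k z)%C z).
  { intros k z Hz. apply (cdiff_inv (v k)); auto. }
  assert (Bw : forall k z, Cmod (z - z0) < R0 -> Cmod (/ v k z) <= / r0).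
  { intros k z Hz. rewrite Cmod_inv by auto. apply Rinv_le_contravar; auto. }
  assert (Tp : forall p r, Cmod (p - z0) + r < R0 -> 0 < r ->
     forall k, exists c, taylor_at (fun z => / v k z)%C p r (/ r0) c).
  { intros p r Hp r1 k.
    assert (In : forall z, Cmod (z - p) <= r -> Cmod (z - z0) < R0).
    { intros z Hz. assert (T := Cmod_triangle3 z p z0). lra. }
    apply cauchy_taylor; auto. intros z Hz. apply Bw, In. rewrite Hz. lra. }
  (* Discs of radius R0 / 2 about points of the R0 / 4 disc stay within 3 R0 / 4, where convergence
     must be uniform, hence an expansion on the slightly larger radius 7 R0 / 8. Each of them also
     covers the R0 / 4 disc, so a zero that spreads reaches all of it. *)
  destruct (taylor_compactness (fun k z => / v k z)%C z0 (7 * R0 / 8) (/ r0)) as (s & w & Hs & _ & U);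
    [lra|apply Tp; [|lra]; replace (z0 - z0)%C with (RtoC 0) by ring; rewrite Cmod_0; lra|].
  specialize (U (3 * R0 / 4) ltac:(lra)).
  assert (Tw : forall p, Cmod (p - z0) < R0 / 4 -> exists c, taylor_at w p (R0 / 2) (/ r0) c).
  { intros p Hp. apply (taylor_limit (fun k z => / v (s k) z)%C); [lra| |].
    - intros k. apply Tp; lra.
    - intros z Hz eps He. generalize (U eps He). apply filter_imp. intros k Hk. apply Hk.
      assert (T := Cmod_triangle3 z p z0). lra. }
  exists s. split; [auto|].
  destruct (classic (exists p, Cmod (p - z0) < R0 / 4 /\ w p = 0)) as [(p & Hp & Wp)|N].
  - right. destruct (Tw p Hp) as (c & T).
    assert (Near : forall z, Cmod (z - p) < R0 / 2 -> Cmod (z - z0) <= 3 * R0 / 4).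
    { intros z Hz. assert (T1 := Cmod_triangle3 z p z0). lra. }
    destruct (taylor_isolated_zero w p (R0 / 2) (/ r0) c ltac:(lra) T) as [Z|(t & d & Ht & d0 & Hd)].
    + intros L. assert (L1 : 0 < Rabs L + 1) by (assert (A := Rabs_pos L); lra).
      generalize (U (/ (Rabs L + 1)) ltac:(apply Rinv_0_lt_compat; auto)). apply filter_imp.
      intros k Hk z Hz. specialize (Hk z ltac:(lra)).
      rewrite Z in Hk by (assert (T1 := Cmod_triangle3 z z0 p); rewrite (Cmod_minus_sym z0 p) in T1; lra).
      replace (/ v (s k) z - 0)%C with (/ v (s k) z)%C in Hk by ring.
      assert (HzR : Cmod (z - z0) < R0) by lra. assert (Pv := Hlow (s k) z HzR).
      rewrite Cmod_inv in Hk by (apply NZ; exact HzR).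
      assert (Hgt : Rabs L + 1 < Cmod (v (s k) z)) by (apply Rinv_lt_cancel; [lra|exact Hk]).
      assert (A := Rle_abs L). lra.
    + exfalso. destruct (U (d / 2) ltac:(lra)) as [K HK]. specialize (HK K (le_n _)).
      assert (B : forall z, on_circle p t z -> Cmod (v (s K) z) <= 2 / d).
      { intros z Hz. assert (Q : Cmod (z - z0) <= 3 * R0 / 4) by (apply Near; rewrite Hz; lra).
        specialize (HK z Q). specialize (Hd z Hz).
        assert (T1 := Cmod_triangle_minus (w z) (/ v (s K) z)). rewrite Cmod_minus_sym in T1.
        assert (nz := NZ (s K) z ltac:(lra)). rewrite Cmod_inv in T1 by auto.
        apply Cmod_gt_0 in nz. set (x := Cmod (v (s K) z)) in *.
        apply Rle_div_r; [auto|]. assert (/ x * x = 1) by (field; lra).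
        assert (d / 2 <= / x) by lra. nra. }
      (* The remainder bound with [N = 0] and [eta = 0] is the maximum principle |v(p)| <= 2 / d. It
         contradicts |1 / v(p)| < d / 2, which holds because [w p = 0]. *)
      destruct (cauchy_taylor (v (s K)) p t (2 / d)) as (c' & _ & T'); [lra| |auto|].
      { intros z Hz. apply Hv. assert (Q := Near z ltac:(lra)). lra. }
      specialize (T' O 0 ltac:(rewrite Cmod_0; lra)). simpl in T'.
      rewrite Cmod_0 in T'. replace (p + 0)%C with p in T' by ring.
      replace (v (s K) p - 0)%C with (v (s K) p) in T' by ring.
      replace (2 / d * 1 * (t / (t - 0))) with (2 / d) in T' by (field; lra).
      specialize (HK p ltac:(lra)). rewrite Wp in HK.
      replace (/ v (s K) p - 0)%C with (/ v (s K) p)%C in HK by ring.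
      assert (nz := NZ (s K) p ltac:(lra)). rewrite Cmod_inv in HK by auto.
      apply Cmod_gt_0 in nz. set (x := Cmod (v (s K) p)) in *.
      assert (/ x * x = 1) by (field; lra). apply Rle_div_r in T'; [|auto]. nra.
  - left. exists w. split.
    + intros z Hz. split; [intro Wz; apply N; now exists z|].
      destruct (Tw z Hz) as (c & T). apply (taylor_cdiff w z (R0 / 2) (/ r0) c); [lra|auto].
    + intros eps He. generalize (U eps He). apply filter_imp. intros k Hk z Hz. apply Hk. lra.
Qed.

(** * Fatou sets *)

Lemma entire_cdiff (f : C -> C) : entire f -> forall z, cdiff f z.
Proof. intros Hf z. apply cdiff_ex_derive, Hf. exact I. Qed.

Lemma transcendental_unbounded (f : C -> C) (M : R) :
  transcendental_entire f -> exists p, M < Cmod (f p).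
Proof.
  intros [He Hp]. apply NNPP; intro N. apply Hp. exists O, (fun _ => f 0). intros z.
  rewrite sum_O. simpl. rewrite Cmult_1_r. apply (liouville f M); [apply entire_cdiff, He|].
  intros w. apply Rnot_lt_le. intro L. apply N. now exists w.
Qed.

Lemma bounded_on_disc (f : C -> C) (M : R) :
  (forall z, cont f z) -> exists B, forall z, Cmod z <= M -> Cmod (f z) <= B.
Proof.
  intros Hf. apply NNPP; intro N.
  assert (H : forall k, exists z, Cmod z <= M /\ INR k < Cmod (f z)).
  { intros k. apply NNPP; intro A. apply N. exists (INR k). intros z Hz.
    apply Rnot_lt_le. intro L. apply A. now exists z. }
  set (u := fun k => proj1_sig (constructive_indefinite_description _ (H k))).
  assert (Hu : forall k, Cmod (u k) <= M /\ INR k < Cmod (f (u k))).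
  { intros k. apply (proj2_sig (constructive_indefinite_description _ (H k))). }
  destruct (bolzano_C u M) as (s & l & Hs & Hl); [apply Hu|].
  destruct (tends_cont f _ l (Hf l) Hl 1 ltac:(lra)) as [K HK].
  destruct (INR_archimed 1 (Cmod (f l) + 1) ltac:(lra)) as [K2 HK2].
  specialize (HK (K + K2)%nat ltac:(lia)). destruct (Hu (s (K + K2)%nat)) as [_ B].
  assert (G := strict_incr_ge s Hs (K + K2)%nat).
  assert (G2 : INR K2 <= INR (s (K + K2)%nat)) by (apply le_INR; lia).
  assert (T := Cmod_triangle_minus (f (u (s (K + K2)%nat))) (f l)). lra.
Qed.

(** Convergence is uniform only near each point of [U]. If the values on the closed disc were
    unbounded, points with large values would accumulate at some [l], but near [a l] the sequence is
    eventually within 1 of the continuous [phi]. *)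
Lemma loc_unif_bounded (U : C -> Prop) (u : nat -> C -> C) (phi a : C -> C) (z0 : C) (r : R) :
  holomorphic_on U phi -> loc_unif_cvg U u phi -> (forall z, cont a z) ->
  (forall z, Cmod (z - z0) <= r -> U (a z)) -> 0 < r ->
  exists M, eventually (fun k => forall z, Cmod (z - z0) <= r -> Cmod (u k (a z)) <= M).
Proof.
  intros Hphi Hu Ha HU r0. apply NNPP; intro N.
  assert (H : forall j n, exists p, (n <= p)%nat /\
            exists z, Cmod (z - z0) <= r /\ INR j < Cmod (u p (a z))).
  { intros j n. apply NNPP; intro A. apply N. exists (INR j), n. intros k Hk z Hz.
    apply Rnot_lt_le. intro L. apply A. exists k. split; [auto|]. now exists z. }
  destruct (extract_subseq _ H) as (s & Hs & Hx).
  set (x := fun k => proj1_sig (constructive_indefinite_description _ (Hx k))).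
  assert (Px : forall k, Cmod (x k - z0) <= r /\ INR k < Cmod (u (s k) (a (x k)))).
  { intros k. apply (proj2_sig (constructive_indefinite_description _ (Hx k))). }
  destruct (bolzano_C x (r + Cmod z0)) as (t & l & Ht & Hl).
  { intros k. assert (T := Cmod_triangle_minus (x k) z0). specialize (Px k). lra. }
  assert (Ll : Cmod (l - z0) <= r).
  { apply (tends_Cmod_le eventually (fun k => x (t k) - z0)%C).
    - apply (tends_minus eventually (fun k => x (t k))); [exact Hl|apply tends_const; typeclasses eauto].
    - apply filter_forall. intros k. apply Px. }
  assert (Ul := HU l Ll). assert (Tl := tends_cont a _ l (Ha l) Hl).
  destruct (Hu (a l) Ul) as (V & HV & Hc).
  destruct (proj1 (locally_Cmod _ _) HV) as (d & d0 & Hd).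
  assert (Tphi := tends_cont phi _ _ (cdiff_cont _ _ (proj2 (cdiff_ex_derive phi (a l)) (Hphi _ Ul))) Tl).
  assert (Ev := eventually_subseq _ (strict_incr_comp s t Hs Ht) _ (Hc 1 ltac:(lra))).
  destruct (eventually_and _ _ Ev (eventually_and _ _ (Tl d d0) (Tphi 1 ltac:(lra)))) as [K HK].
  destruct (INR_archimed 1 (Cmod (phi (a l)) + 2) ltac:(lra)) as [K2 HK2].
  destruct (HK (K + K2)%nat ltac:(lia)) as (A1 & A2 & A3).
  set (k := (K + K2)%nat) in *. destruct (Px (t k)) as [P1 P2].
  specialize (A1 _ (Hd _ A2) (HU _ P1)).
  assert (G := strict_incr_ge t Ht k).
  assert (G2 : INR K2 <= INR (t k)) by (apply le_INR; unfold k in *; lia).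
  assert (T1 := Cmod_triangle_minus (u (s (t k)) (a (x (t k)))) (phi (a (x (t k))))).
  assert (T2 := Cmod_triangle_minus (phi (a (x (t k)))) (phi (a l))).
  unfold Cminus in *. lra.
Qed.

(** Though [w] has no zero in [V], it may approach 0 towards the boundary; hence the neighbourhood
    [W], on which |w| stays above half its value at [p]. *)
Lemma inv_loc_unif (V : C -> Prop) (v : nat -> C -> C) (w : C -> C) (p : C) :
  (forall k z, V z -> v k z <> 0) -> (forall z, V z -> w z <> 0 /\ cdiff w z) -> V p ->
  (forall eps, 0 < eps -> eventually (fun k => forall z, V z -> Cmod (/ v k z - w z) < eps)) ->
  exists W : C -> Prop, locally p W /\ forall eps, 0 < eps ->
    eventually (fun k => forall z, W z -> V z -> Cmod (v k z - / w z) < eps).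
Proof.
  intros Hv Hw Vp H. destruct (Hw p Vp) as [wp Dp]. apply Cmod_gt_0 in wp.
  set (m := Cmod (w p)) in *.
  exists (fun z => Cmod (w z - w p) < m / 2). split.
  - apply (cdiff_cont w p Dp). lra.
  (* The difference v - 1/w has modulus |v| |1/v - w| / |w|. Here |1/v| > m / 4 and |w| > m / 2, so
     it is below (4 / m) (eps m^2 / 16) (2 / m) = eps / 2. *)
  - intros eps He. set (e := Rmin (m / 4) (eps * (m * m) / 16)).
    assert (mm : 0 < m * m) by nra.
    assert (e0 : 0 < e) by (apply Rmin_pos; [lra|]; nra).
    assert (e1 : e <= m / 4) by apply Rmin_l. assert (e2 : e <= eps * (m * m) / 16) by apply Rmin_r.
    generalize (H e e0). apply filter_imp. intros k Hk z Wz Vz. specialize (Hk z Vz).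
    assert (nv := Hv k z Vz). destruct (Hw z Vz) as [nw _].
    assert (T1 := Cmod_triangle_minus (w p) (w z)). rewrite Cmod_minus_sym in T1. fold m in T1.
    assert (T2 := Cmod_triangle_minus (w z) (/ v k z)). rewrite Cmod_minus_sym in T2.
    replace (v k z - / w z)%C with (- (v k z * ((/ v k z - w z) / w z)))%C by (field; auto).
    rewrite Cmod_opp, Cmod_mult, Cmod_div by auto. rewrite Cmod_inv in T2 by auto.
    assert (pv : 0 < Cmod (v k z)) by (apply Cmod_gt_0; auto).
    set (X := Cmod (v k z)) in *. set (Y := Cmod (w z)) in *. set (D := Cmod (/ v k z - w z)) in *.
    assert (D0 : 0 <= D) by apply Cmod_ge_0.
    assert (XX : X * / X = 1) by (field; lra).
    assert (X * (m / 4) <= 1) by nra.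
    replace (X * (D / Y)) with (X * D / Y) by (field; lra).
    apply Rlt_div_l; [lra|].
    assert (X * D <= X * (eps * (m * m) / 16)) by (apply Rmult_le_compat_l; lra).
    assert (X * (m / 4) * (eps * m / 4) <= 1 * (eps * m / 4)) by (apply Rmult_le_compat_r; nra).
    nra.
Qed.

(* Finite limits: [a (u k)] stays bounded near [z0], so [u k] omits a disc on which the
   unbounded function [a] is large, and Montel's theorem for bounded families applies to the
   reciprocals. *)
Lemma fatou_backward_invariant (F : (C -> C) -> Prop) (a : C -> C) (z0 : C) :
  (forall u, F u -> forall z, cdiff u z) -> (forall u, F u -> forall z, u (a z) = a (u z)) ->
  transcendental_entire a -> fatou_set F (a z0) -> fatou_set F z0.
Proof.
  intros HF Hcomm Ta (U & oU & Ua & nU).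
  assert (Ca : forall z, cont a z) by (intros z; apply cdiff_cont, entire_cdiff, Ta).
  destruct (proj1 (locally_Cmod _ _) (oU _ Ua)) as (d1 & d10 & Hd1).
  destruct (proj1 (locally_Cmod _ _) (Ca z0 d1 d10)) as (d2 & d20 & Hd2).
  (* Halving makes [a] map the closed disc of radius [r] into [U], as the compactness argument of
     [loc_unif_bounded] requires. *)
  set (r := d2 / 2). assert (r0 : 0 < r) by (unfold r; lra).
  assert (HU : forall z, Cmod (z - z0) <= r -> U (a z)).
  { intros z Hz. apply Hd1, Hd2. unfold r in Hz. lra. }
  set (V := fun z => Cmod (z - z0) < r / 4).
  exists V. split; [|split].
  - intros z Hz. apply locally_Cmod. exists (r / 4 - Cmod (z - z0)). unfold V in *. split; [lra|].
    intros w Hw. assert (T := Cmod_triangle3 w z z0). lra.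
  - unfold V. replace (z0 - z0)%C with (RtoC 0) by ring. rewrite Cmod_0. lra.
  - intros u Hu. destruct (nU u Hu) as (s & Hs & [(phi & Hphi & Hc)|Hinf]).
    + destruct (loc_unif_bounded U (fun k => u (s k)) phi a z0 r Hphi Hc Ca HU r0) as (M & K & HK).
      destruct (transcendental_unbounded a M Ta) as [p0 Hp0].
      destruct (proj1 (locally_Cmod _ _) (Ca p0 (Cmod (a p0) - M) ltac:(lra))) as (e & e0 & He).
      (* The first [K] terms are dropped, since [bounded_below_normal] wants its lower bound for
         every index and [M] bounds the sequence only from [K] on. *)
      set (v := fun k z => (u (s (K + k)%nat) z - p0)%C).
      destruct (bounded_below_normal v z0 r e r0 e0) as (t & Ht & Hres).
      * intros k z _. apply cdiff_minus; [apply HF, Hu|apply cdiff_const].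
      * intros k z Hz. apply Rnot_lt_le. intro L. specialize (He _ L).
        specialize (HK (K + k)%nat ltac:(lia) z ltac:(lra)). cbv beta in HK.
        rewrite Hcomm in HK by apply Hu.
        assert (T := Cmod_triangle_minus (a p0) (a (u (s (K + k)%nat) z))).
        rewrite Cmod_minus_sym in T. lra.
      * exists (fun k => s (K + t k)%nat). split.
        { intros k. apply strict_incr_lt; [exact Hs|]. specialize (Ht k). lia. }
        assert (NZ : forall k z, V z -> v (t k) z <> 0).
        { intros k z Hz E. assert (Hz' : Cmod (z - z0) < r) by (unfold V in Hz; lra).
          assert (Q : u (s (K + t k)%nat) z = p0) by (apply Cminus_eq_0, E).
          specialize (HK (K + t k)%nat ltac:(lia) z ltac:(lra)). cbv beta in HK.
          rewrite Hcomm, Q in HK by apply Hu. lra. }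
        destruct Hres as [(w & Hw & Hcw)|Hi].
        { left. exists (fun z => / w z - - p0)%C. split.
          - intros z Hz. apply cdiff_ex_derive. destruct (Hw z Hz).
            apply (cdiff_minus (fun z => / w z)%C (fun _ => - p0)%C); [apply cdiff_inv; auto|apply cdiff_const].
          - intros p Hp. destruct (inv_loc_unif V (fun k => v (t k)) w p NZ Hw Hp Hcw) as (W & HW & HC).
            exists W. split; [exact HW|]. intros eps Heps. generalize (HC eps Heps). apply filter_imp.
            intros k Hk z Wz Vz. specialize (Hk z Wz Vz). unfold v in Hk.
            replace (u (s (K + t k)%nat) z - (/ w z - - p0))%C with (u (s (K + t k)%nat) z - p0 - / w z)%C by ring.
            exact Hk. }
        { right. intros p Hp. exists (fun _ => True). split; [apply filter_forall; auto|].
          intros L. generalize (Hi (L + Cmod p0)). apply filter_imp. intros k Hk z _ Vz.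
          specialize (Hk z Vz). unfold v in Hk.
          assert (T := Cmod_triangle (u (s (K + t k)%nat) z) (- p0)). rewrite Cmod_opp in T.
          unfold Cminus in Hk. lra. }
    + exists s. split; [exact Hs|]. right. intros p Hp.
      destruct (Hinf (a p)) as (W & HW & HI). { apply HU. unfold V in Hp. lra. }
      exists (fun z => W (a z)). split.
      * apply (proj2 (filterlim_tends (locally p) a (a p)) (Ca p)). exact HW.
      (* If |u_k(z)| were at most [L], then u_k(a z) = a(u_k(z)) would be at most [B], the bound of
         [a] on that disc. *)
      * intros L. destruct (bounded_on_disc a L Ca) as [B HB].
        generalize (HI B). apply filter_imp. intros k Hk z Wz Vz.
        assert (Uz : U (a z)) by (apply HU; unfold V in Vz; lra).
        specialize (Hk _ Wz Uz). cbv beta in Hk. rewrite Hcomm in Hk by apply Hu.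
        apply Rnot_le_lt. intro Q. specialize (HB _ Q). lra.
Qed.

(** A separation of the image would make [chi], with values 0 and 1, continuous on the line, and the
    intermediate value theorem would give it the value 1/2. *)
Lemma connected_image (h : R -> C) :
  (forall t, tends (locally t) h (h t)) -> connected_set (fun z => exists t, z = h t).
Proof.
  intros Hh U V oU oV HUV (z1 & (t1 & E1) & U1) (z2 & (t2 & E2) & V2). apply NNPP; intro N.
  subst z1 z2.
  set (chi := fun t => if excluded_middle_informative (U (h t)) then 0 else 1).
  assert (Ev : forall W : C -> Prop, open W -> forall t, W (h t) -> locally t (fun y => W (h y))).
  { intros W oW t Wt. apply (proj2 (filterlim_tends (locally t) h (h t)) (Hh t)). exact (oW _ Wt). }
  assert (Cc : continuity chi).
  { intros t. apply continuity_pt_locally. intros eps.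
    destruct (classic (U (h t))) as [Ut|Ut].
    - generalize (Ev U oU t Ut). apply filter_imp. intros y Uy. unfold chi.
      destruct (excluded_middle_informative (U (h y))); [|contradiction].
      destruct (excluded_middle_informative (U (h t))); [|contradiction].
      rewrite Rminus_0_r, Rabs_R0. apply cond_pos.
    - assert (Vt : V (h t)) by (destruct (HUV (h t)); [now exists t|contradiction|assumption]).
      generalize (Ev V oV t Vt). apply filter_imp. intros y Vy. unfold chi.
      destruct (excluded_middle_informative (U (h y))) as [Uy|_].
      { exfalso. apply N. exists (h y). split; [now exists y|]. split; assumption. }
      destruct (excluded_middle_informative (U (h t))); [contradiction|].
      rewrite Rminus_diag, Rabs_R0. apply cond_pos. }
  destruct (IVT_gen chi t1 t2 (1 / 2) Cc) as (t & _ & Ht).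
  - unfold chi. destruct (excluded_middle_informative (U (h t1))); [|contradiction].
    destruct (excluded_middle_informative (U (h t2))) as [U2|_].
    + exfalso. apply N. exists (h t2). split; [now exists t2|]. split; assumption.
    + rewrite Rmin_left, Rmax_right; lra.
  - unfold chi in Ht. destruct (excluded_middle_informative (U (h t))); lra.
Qed.

(** The component is the union of all connected subsets of [S] through [c]. Two open sets that cover
    it both meet some member that also contains [c]: whichever of them holds [c], the member
    reaching the other one must meet both. *)
Lemma connected_subset_component (S B : C -> Prop) :
  connected_set B -> (forall z, B z -> S z) -> (exists z, B z) ->
  exists A, connected_component_of S A /\ forall z, B z -> A z.
Proof.
  intros cB BS [c Bc].
  exists (fun z => exists D, connected_set D /\ (forall w, D w -> S w) /\ D c /\ D z).
  split; [|intros z Bz; exists B; auto].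
  split; [exists c; exists B; auto|]. split; [|split].
  - intros U V oU oV HUV (x & (D1 & C1 & S1 & D1c & D1x) & Ux) (y & (D2 & C2 & S2 & D2c & D2y) & Vy).
    assert (In1 : forall z, D1 z -> exists D, connected_set D /\ (forall w, D w -> S w) /\ D c /\ D z)
      by (intros z Hz; exists D1; auto).
    assert (In2 : forall z, D2 z -> exists D, connected_set D /\ (forall w, D w -> S w) /\ D c /\ D z)
      by (intros z Hz; exists D2; auto).
    destruct (HUV c (In1 c D1c)) as [Uc|Vc].
    + destruct (C2 U V oU oV (fun z Dz => HUV z (In2 z Dz)) (ex_intro _ c (conj D2c Uc)) (ex_intro _ y (conj D2y Vy)))
        as (z & Dz & Uz & Vz). exists z. auto.
    + destruct (C1 U V oU oV (fun z Dz => HUV z (In1 z Dz)) (ex_intro _ x (conj D1x Ux)) (ex_intro _ c (conj D1c Vc)))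
        as (z & Dz & Uz & Vz). exists z. auto.
  - intros z (D & _ & SD & _ & Dz). auto.
  - intros D cD SD AD z Dz. exists D. repeat split; auto. apply AD. exists B; auto.
Qed.

(** * From one generator to the semigroup *)

Lemma generated_monotone (n : nat) (g : Fin.t n -> C -> C) (i : Fin.t n) (u : C -> C) :
  generated 1 (fun _ => g i) u -> generated n g u.
Proof. induction 1; [apply generated_gen|apply generated_comp; auto]. Qed.

Lemma fatou_set_antimonotone (F1 F2 : (C -> C) -> Prop) (z : C) :
  (forall u, F1 u -> F2 u) -> fatou_set F2 z -> fatou_set F1 z.
Proof.
  intros H (U & oU & Uz & nU). exists U. split; [auto|]. split; [auto|].
  intros u Hu. apply nU. auto.
Qed.

Lemma generated_cdiff (n : nat) (g : Fin.t n -> C -> C) (u : C -> C) :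
  (forall i z, cdiff (g i) z) -> generated n g u -> forall z, cdiff u z.
Proof. intros Hg. induction 1; intros z; [auto|]. apply (cdiff_comp f h); auto. Qed.

(** A composition is pulled back one factor at a time, and a single generator commutes with every
    iterate of [g i], by induction on the iterate. *)
Lemma generated_backward (n : nat) (g : Fin.t n -> C -> C) (i : Fin.t n) (f : C -> C) :
  (forall i, transcendental_entire (g i)) -> abelian_generators n g -> generated n g f ->
  forall z, fatou_set_of_function (g i) (f z) -> fatou_set_of_function (g i) z.
Proof.
  intros Ht Hab. induction 1 as [j|f h _ IHf _ IHh]; intros z Hz; [|auto].
  apply (fatou_backward_invariant _ (g j)); auto.
  - intros u Hu. apply (generated_cdiff 1 (fun _ => g i)); auto.
    intros _ w. apply entire_cdiff, Ht.
  - intros u Hu. induction Hu as [k|f h _ IHf _ IHh]; intros w; [apply Hab|].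
    now rewrite IHh, IHf.
Qed.

Theorem theorem3p8 (n : nat) (g : Fin.t n -> C -> C)
  (hn : (1 <= n)%nat)
  (htrans : forall i : Fin.t n, transcendental_entire (g i))
  (habel : abelian_generators n g)
  (hbdd : forall (i : Fin.t n) (A : C -> Prop),
      fatou_component (g i) A -> bounded_set A) :
  forall zeta : C,
    fatou_set (generated n g) zeta ->
    ~ family_asymptotic_value (generated n g) zeta.
Proof.
  intros zeta Hzeta (f & Hf & gamma & Cg & Lg & Fg).
  destruct n as [|m]; [lia|]. set (i := Fin.F1 : Fin.t (S m)).
  assert (Hz : fatou_set_of_function (g i) zeta)
    by (apply (fatou_set_antimonotone _ (generated (S m) g)); [apply generated_monotone|exact Hzeta]).
  destruct Hz as (U & oU & Uz & nU).
  destruct (Fg U (oU _ Uz)) as [T0 HT0].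
  (* Times from [T] on exceed [T0], so [f] maps the tail into [U], and they are nonnegative, where
     [gamma] is known to be continuous. *)
  set (T := Rmax T0 0 + 1).
  assert (TA := Rmax_l T0 0). assert (TB := Rmax_r T0 0).
  (* Folding the line by the absolute value parametrizes the tail by all of [R], as
     [connected_image] expects. *)
  set (h := fun t => gamma (T + Rabs t)).
  assert (Sh : forall z, (exists t, z = h t) -> fatou_set_of_function (g i) z).
  { intros z [t ->]. apply (generated_backward (S m) g i f htrans habel Hf).
    exists U. split; [exact oU|]. split; [|exact nU]. apply HT0.
    assert (A := Rabs_pos t). unfold T. lra. }
  assert (Ch : forall t, tends (locally t) h (h t)).
  { intros t eps He.
    assert (A := Rabs_pos t).
    assert (Q := Cg (T + Rabs t) ltac:(unfold T; lra)
      (fun w => Cmod (w - h t) < eps) (proj2 (locally_Cmod _ _) (ex_intro _ eps (conj He (fun w Hw => Hw))))).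
    destruct Q as [d Hd]. exists d. intros y Hy. apply Hd.
    - change (Rabs (T + Rabs y - (T + Rabs t)) < d).
      replace (T + Rabs y - (T + Rabs t)) with (Rabs y - Rabs t) by ring.
      eapply Rle_lt_trans; [apply Rabs_triang_inv2|exact Hy].
    - assert (B := Rabs_pos y). unfold T. lra. }
  destruct (connected_subset_component _ _ (connected_image h Ch) Sh (ex_intro _ (h 0) (ex_intro _ 0 eq_refl)))
    as (A & HA & BA).
  destruct (hbdd i A HA) as [M HM].
  apply is_lim_spec in Lg. destruct (Lg M) as [T1 HT1].
  (* With this [t] the time T + |t| exceeds [T1], so the curve has modulus above [M] there although
     it lies in the bounded component. *)
  set (t := Rabs T1 + 1). assert (P1 := Rle_abs T1). assert (P2 := Rabs_pos T1).
  assert (B := HM _ (BA _ (ex_intro _ t eq_refl))).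
  specialize (HT1 (T + Rabs t) ltac:(rewrite (Rabs_pos_eq t); unfold t, T; lra)).
  unfold h in B. lra.
Qed.
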